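(* Let $G$ be (the vertex set of) a connected locally finite graph with graph distance $d$, origin $o$, and a measure $\mu$ on the vertices (finite on each vertex, $\mu(G)=\infty$), and let $F(r)=\mu(B_r(o))$. Assume there is $r_0>0$ with $\liminf_{r\to\infty}F(r+r_0)/F(r)>1$ and $\limsup_{r\to\infty}F(r+r_0)/F(r)<\infty$. For each $\lambda>0$, let $X^{(\lambda)}$ be a Poisson point process on $G$ with intensity measure $\lambda\mu$, and let $Y^{(\lambda)}$ be a Bernoulli point process on $G$ with probabilities $x\mapsto\min\{1,\lambda\mu(x)\}$. Then $d_P(\mathrm{Vor}(X^{(\lambda)}),\mathrm{Vor}(Y^{(\lambda)}))\to0$ as $\lambda\to0$, provided that $\lim_{n\to\infty}\mu^2(B_n(o))/\mu(B_n(o))^2=0$, where $\mu^2(A)=\sum_{x\in A}\mu(x)^2$. As a result, $\mathrm{Vor}(X^{(\lambda)})$ and $\mathrm{Vor}(Y^{(\lambda)})$ have the same subsequential weak limits as $\lambda\to0$.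
   Context: $B_r(o)$ is the closed ball. A Bernoulli point process with probabilities $x\mapsto a(x)$ contains each vertex $x$ independently with probability $a(x)$. For a locally finite (multi)set $Z$ of vertices, $\mathrm{Vor}(Z)$ is the unordered collection of the cells $\{y\in G:d(y,x)\le d(y,x')\ \forall x'\in Z\}$, $x\in Z$. It is regarded as a point process of closed subsets: a random multiset of nonempty subsets of $G$, only finitely many of which meet any finite set, viewed as a random point measure on the space of nonempty closed subsets of $G$ with the Fell topology; the space of such point measures carries the vague topology. $d_P$ is the Prokhorov distance between the laws of the two random elements (with respect to a fixed metric metrizing that topology). *)

(* Defs.v *)
From HB Require Import structures.
From mathcomp Require Import all_boot all_order all_algebra finmap.
From mathcomp Require Import all_classical all_reals all_analysis.

Set Implicit Arguments.
Unset Strict Implicit.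
Unset Printing Implicit Defensive.

Import Order.TTheory GRing.Theory Num.Theory.
Import numFieldNormedType.Exports.

Local Open Scope classical_set_scope.
Local Open Scope ring_scope.

(* Loops are allowed: they do not affect the graph distance. *)
Record rooted_graph := RootedGraph {
  vertex : choiceType;
  root : vertex;
  adj : rel vertex;
  adj_sym : symmetric adj;
  adj_locally_finite : forall x, finite_set [set y | adj x y];
  adj_connected : forall x y, exists2 p, path adj x p & last x p = y }.

(* The vertex set as a discrete topological and discrete measurable space,
   pointed at the origin. *)
Definition vertices (G : rooted_graph) : Type := vertex G.

HB.instance Definition _ (G : rooted_graph) :=
  Choice.copy (vertices G) (vertex G).
HB.instance Definition _ (G : rooted_graph) :=
  isPointed.Build (vertices G) (root G).
HB.instance Definition _ (G : rooted_graph) :=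
  DiscreteTopology.copy (vertices G) (discrete_topology (vertex G)).
HB.instance Definition _ (G : rooted_graph) :=
  @isMeasurable.Build default_measure_display (vertices G)
    discrete_measurable discrete_measurable0
    discrete_measurableC discrete_measurableU.

Section graph_distance.
Variable G : rooted_graph.
Implicit Types x y : vertices G.

Definition has_walk x y (n : nat) : bool :=
  `[< exists2 p : seq (vertex G),
        size p = n & path (@adj G) x p /\ last x p = y >].

Fact has_walk_ex x y : exists n, has_walk x y n.
Proof.
have [p px py] := adj_connected x y.
by exists (size p); apply/asboolP; exists p.
Qed.

Definition gdist x y : nat := ex_minn (has_walk_ex x y).

Lemma gdistxx x : gdist x x = 0%N.
Proof.
rewrite /gdist; case: ex_minnP => m _ /(_ 0%N) H.
by apply/eqP; rewrite -leqn0 H//; apply/asboolP; exists [::].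
Qed.

Lemma finite_walk x n : finite_set [set y | has_walk x y n].
Proof.
elim: n => [|n IH].
  apply: (sub_finite_set _ (finite_set1 x)) => y /asboolP[p].
  by move=> /size0nil-> [_ /= ->].
apply: (@sub_finite_set _ _ (\bigcup_(z in [set y | has_walk x y n])
          [set y | adj z y])); last first.
  by apply: bigcup_finite => // z _; exact: adj_locally_finite.
move=> y /asboolP[p]; case/lastP: p => [//|p z].
rewrite size_rcons last_rcons rcons_path => -[pn] [/andP[xp pz] zy].
exists (last x p); last by rewrite /= -zy.
by apply/asboolP; exists p.
Qed.

Lemma finite_gdist x n : finite_set [set y | (gdist x y <= n)%N].
Proof.
apply: (@sub_finite_set _ _ (\bigcup_(k in `I_n.+1) [set y | has_walk x y k])).
  move=> y /= xyn; exists (gdist x y) => //=.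
  by rewrite /gdist; case: ex_minnP.
by apply: bigcup_finite => // k _; exact: finite_walk.
Qed.

End graph_distance.

Section closed_sets.
Variable T : topologicalType.

Record closed_ne := ClosedNe {
  closed_ne_set :> set T;
  closed_ne_closed : closed closed_ne_set;
  closed_ne_nonempty : closed_ne_set !=set0 }.

HB.instance Definition _ := gen_eqMixin closed_ne.
HB.instance Definition _ := gen_choiceMixin closed_ne.

(* Subbase of the Fell topology: the sets missing a compact set and the sets
   hitting an open set. *)
Definition fell_subbase : set (set closed_ne) :=
  [set [set F : closed_ne | F `&` K = set0] | K in compact] `|`
  [set [set F : closed_ne | F `&` U !=set0] | U in open].

HB.instance Definition _ := isSubBaseTopological.Build closed_ne
  fell_subbase id.

End closed_sets.

(* The multiset in which F has multiplicity pm_mult F, identified with the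
   point measure \sum_F (pm_mult F) \delta_F. *)
Record point_measure (G : rooted_graph) := PointMeasure {
  pm_mult :> closed_ne (vertices G) -> nat;
  pm_locally_finite : forall K : set (vertices G), finite_set K ->
    finite_set [set F | pm_mult F <> 0%N /\ F `&` K !=set0] }.

(* Point measures with the vague topology; R is where the test functions take
   their values. *)
Definition vague (R : realType) (G : rooted_graph) : Type := point_measure G.

Section vague_topology.
Variables (R : realType) (G : rooted_graph).

Definition test_function (f : closed_ne (vertices G) -> R) : Prop :=
  continuous f /\ compact (closure [set F | f F != 0]).

(* The integral of f against the point measure \sum_F (c F) \delta_F.  A
   compact set of nonempty closed sets consists of sets hitting a common
   finite K, so for a test function f the sum has finite support. *)
Definition pm_integral (c : point_measure G)
    (f : closed_ne (vertices G) -> R) : R :=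
  \sum_(F \in [set: closed_ne (vertices G)]) (c F)%:R * f F.

Fact pm_zero_locally_finite (K : set (vertices G)) : finite_set K ->
  finite_set [set F : closed_ne (vertices G) | 0%N <> 0%N /\ F `&` K !=set0].
Proof. by move=> _; apply: (sub_finite_set _ (finite_set0 _)) => F []. Qed.

HB.instance Definition _ := gen_eqMixin (vague R G).
HB.instance Definition _ := gen_choiceMixin (vague R G).
HB.instance Definition _ :=
  isPointed.Build (vague R G) (PointMeasure pm_zero_locally_finite).

Definition vague_subbase : set (set (vague R G)) :=
  [set A | exists f (U : set R), [/\ test_function f, open U &
                                  A = [set c | U (pm_integral c f)]]].

HB.instance Definition _ := isSubBaseTopological.Build (vague R G)
  vague_subbase id.

Definition borel_vague := g_sigma_algebraType (@open (vague R G)).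

End vague_topology.

Section voronoi.
Variable G : rooted_graph.
Implicit Types (Z : vertices G -> nat) (x y : vertices G).

(* Z x is the multiplicity of x in the multiset Z. *)
Definition cell Z x : set (vertices G) :=
  [set y | forall x', (0 < Z x')%N -> (gdist y x <= gdist y x')%N].

Fact cell_nonempty Z x : cell Z x !=set0.
Proof. by exists x => x' _; rewrite gdistxx. Qed.

Definition vor_cell Z x : closed_ne (vertices G) :=
  ClosedNe (@discrete_closed (vertices G) (cell Z x)) (cell_nonempty Z x).

Definition vor_mult Z (F : closed_ne (vertices G)) : nat :=
  \big[addn/0%N]_(x \in [set x | vor_cell Z x = F]) Z x.

Fact vor_locally_finite Z (K : set (vertices G)) : finite_set K ->
  finite_set [set F | vor_mult Z F <> 0%N /\ F `&` K !=set0].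
Proof.
move=> finK.
have ex F : vor_mult Z F <> 0%N -> exists2 x, (0 < Z x)%N & vor_cell Z x = F.
  move=> F0; apply: contrapT => H; apply: F0.
  rewrite /vor_mult fsbig1// => x xF.
  by apply/eqP; rewrite -leqn0 leqNgt; apply/negP => Zx; apply: H; exists x.
have [[x0 Zx0]|noZ] := pselect (exists x0, (0 < Z x0)%N); last first.
  apply: (sub_finite_set _ (finite_set0 _)) => F [/ex[x Zx _] _].
  by apply: noZ; exists x.
apply: (@sub_finite_set _ _ (vor_cell Z @`
    \bigcup_(y in K) [set x | (gdist y x <= gdist y x0)%N])); last first.
  by apply/finite_image/bigcup_finite => // y _; exact: finite_gdist.
move=> F [/ex[x Zx <-] [y [/= yx Ky]]]; exists x => //.
by exists y => //=; exact: yx.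
Qed.

Definition vor Z : point_measure G := PointMeasure (@vor_locally_finite Z).

Definition multiset_of (S : set (vertices G)) : vertices G -> nat :=
  fun x => (x \in S).

Definition points_in Z (A : set (vertices G)) : nat :=
  \big[addn/0%N]_(x \in A) Z x.

End voronoi.

Section point_processes.
Variables (R : realType) (G : rooted_graph).
Variables (d : measure_display) (Om : measurableType d) (P : probability Om R).
Local Open Scope ereal_scope.

(* In the library, poisson_prob r k is the Poisson law of parameter r (the
   Dirac mass at 0 if r = 0); its argument k is not used. *)
Definition poisson_process (nu : set (vertices G) -> \bar R)
    (X : Om -> vertices G -> nat) : Prop :=
  [/\ forall x, measurable_fun [set: Om] (fun w => X w x),
      forall A, finite_set A -> forall B : set nat,
        P [set w | B (points_in (X w) A)] = poisson_prob (fine (nu A)) 0%N B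
    & forall (n : nat) (A : 'I_n -> set (vertices G)),
        (forall i, finite_set (A i)) -> trivIset [set: 'I_n] A ->
        forall B : 'I_n -> set nat,
        P (\bigcap_i [set w | B i (points_in (X w) (A i))]) =
        \prod_(i < n) P [set w | B i (points_in (X w) (A i))]].

Definition bernoulli_process (a : vertices G -> R)
    (S : Om -> set (vertices G)) : Prop :=
  [/\ forall x, measurable [set w | S w x],
      forall x, P [set w | S w x] = (a x)%:E
    & forall D : {fset vertices G},
        P (\bigcap_(x in [set` D]) [set w | S w x]) =
        \prod_(x <- D) P [set w | S w x]].

(* For W = Vor of a Poisson or Bernoulli process the preimages of Borel sets are
   events: vertices G is countable and Vor is a Borel function of the counts. *)
Definition law (W : Om -> vague R G) : set (vague R G) -> \bar R :=
  pushforward P (W : Om -> borel_vague R G).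

End point_processes.

Section prokhorov.
Variables (R : realType) (G : rooted_graph).
Implicit Types rho : vague R G -> vague R G -> R.

Definition is_metric rho : Prop :=
  [/\ forall x, rho x x = 0, forall x y, rho x y = 0 -> x = y,
      forall x y, rho x y = rho y x
    & forall x y z, rho x z <= rho x y + rho y z].

Definition metrizes rho : Prop :=
  forall A : set (vague R G), open A <->
    (forall x, A x -> exists2 e, 0 < e & [set y | rho x y < e] `<=` A).

Definition neighborhood rho (A : set (vague R G)) (e : R) : set (vague R G) :=
  [set y | exists2 x, A x & rho x y < e].

Definition prokhorov rho (P Q : set (vague R G) -> \bar R) : R :=
  inf [set e | 0 < e /\ forall A : set (borel_vague R G), measurable A ->
    (P A <= Q (neighborhood rho A e) + e%:E)%E /\
    (Q A <= P (neighborhood rho A e) + e%:E)%E].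

End prokhorov.

(* Q is the weak limit of the laws of W l along some sequence l = u k -> 0. *)
Definition subseq_weak_limit (R : realType) (G : rooted_graph)
    (d : measure_display) (Om : R -> measurableType d)
    (P : forall l, probability (Om l) R) (W : forall l, Om l -> vague R G)
    (Q : probability (borel_vague R G) R) : Prop :=
  exists u : nat -> R, [/\ forall k, 0 < u k, u k @[k --> \oo] --> 0
    & forall f : vague R G -> R, continuous f ->
        (exists M, forall c, `|f c| <= M) ->
        (\int[P (u k)]_w (f (W (u k) w))%:E)%E @[k --> \oo] -->
        (\int[Q]_c (f c)%:E)%E].

Section volume.
Variables (R : realType) (G : rooted_graph).
Variable mu : {measure set (vertices G) -> \bar R}.

Definition gball (r : R) : set (vertices G) :=
  [set x | (gdist (root G) x)%:R <= r].

Definition volume (r : R) : R := fine (mu (gball r)).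

Definition mu2 (A : set (vertices G)) : \bar R :=
  (\esum_(x in A) (mu [set x]) ^+ 2)%E.

End volume.

(* Main.v *)
Require Import Defs.
From HB Require Import structures.
From mathcomp Require Import all_boot all_order all_algebra finmap.
From mathcomp Require Import all_classical all_reals all_analysis.
From mathcomp Require Import measurable_realfun lebesgue_integral.
From mathcomp Require Import zify ring lra.

Set Implicit Arguments.
Unset Strict Implicit.
Unset Printing Implicit Defensive.

Import Order.TTheory GRing.Theory Num.Theory.
Import numFieldNormedType.Exports.

Local Open Scope classical_set_scope.
Local Open Scope ring_scope.

(* The occupied balls B_r(o) with F(r) of order 1/lambda confine the cells: as
   soon as a point lies in B_r(o), the traces on B_n(o) of the cells only depend
   on the points in B_(r+2n)(o).  There the Poisson and the Bernoulli processes
   are within total variation distance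
     \sum_x (lambda mu(x))^2 = lambda^2 mu^2(B_(r+2n)(o)),
   which is o((lambda F(r+2n))^2) = o(1), since doubling bounds lambda F(r+2n).
   The same bound makes the numbers of cells meeting each B_k(o) tight, and a
   compactness argument in the space of sequences of cells shows that agreement
   on a large ball B_n(o) forces closeness in any given metric, or of any given
   continuous function, uniformly over the configurations satisfying these
   bounds. *)

(** * Balls and the Fell topology *)

(** The radius r grows without bound as lambda tends to 0, so the points near o carry no limit; only
    the traces of cells do, and these live in the compact space of all subsets of G. Nonempty cells
    may have an empty limit (the cell escapes to infinity), which is why cells are encoded as
    arbitrary subsets and the empty ones are ignored. Compactness is also what allows an arbitrary
    metric on point measures. The order of the choices prevents a circle: the error fixes a lower
    bound M for lambda F(r); M and doubling give bounds C k on lambda F(r+2k) for all k at once;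
    these give bounds L k on the number of cells; only then does compactness yield n; lambda comes
    last. The two processes live on different probability spaces. They are not coupled, but compared
    through expectations of functions of finitely many counts. *)

Lemma open_subbase_filter_base (T : topologicalType) (b : set (set T))
    (P : nat -> set T) (x : T) :
    (forall A : set T, open A ->
       exists2 D : set (set T), D `<=` finI_from b id & \bigcup_(B in D) B = A) ->
    (forall m n, (m <= n)%N -> P n `<=` P m) ->
    (forall B, b B -> B x -> exists n, P n `<=` B) ->
  forall A : set T, open A -> A x -> exists n, P n `<=` A.
Proof.
move=> op Ple bP A oA Ax; move: (oA) (Ax) => /op[D sD <-] [B DB Bx].
have [E sE EB] := sD _ DB.
(* Only finitely many subbasic sets occur in a basic one, and [P] decreases, so the largest of their
   indices serves for all of them. *)
suff [n Pn] : exists n, forall C, C \in E -> P n `<=` C.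
  exists n => y Pny; exists B => //; rewrite -EB => C CE.
  exact: Pn Pny.
have {}sE C : C \in E -> b C /\ C x.
  move=> CE; split; first by have := sE _ CE; rewrite inE.
  by move: Bx; rewrite -EB; apply.
elim/finSet_rect: E sE {EB} => E IH sE.
have [->|[C CE]] := fset_0Vmem E; first by exists 0%N.
have [|n Hn] := IH (E `\ C)%fset (fproperD1 CE).
  by move=> C'; rewrite !inE => /andP[_ /sE].
have [m Hm] := bP _ (sE _ CE).1 (sE _ CE).2.
exists (maxn m n) => C' C'E.
have [->|C'C] := eqVneq C' C.
  by apply: subset_trans Hm; apply: Ple; exact: leq_maxl.
apply: (@subset_trans _ (P n)); first by apply: Ple; exact: leq_maxr.
by apply: Hn; rewrite !inE C'C.
Qed.

Section balls.
Variable G : rooted_graph.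
Implicit Types x y : vertices G.

Lemma has_walkP x y n : reflect (exists2 p : seq (vertex G),
  size p = n & path (@adj G) x p /\ last x p = y) (has_walk x y n).
Proof. exact: asboolP. Qed.

Lemma gdist_le x y n : has_walk x y n -> (gdist x y <= n)%N.
Proof. by rewrite /gdist; case: ex_minnP => m _; apply. Qed.

Lemma has_walk_gdist x y : has_walk x y (gdist x y).
Proof. by rewrite /gdist; case: ex_minnP. Qed.

Lemma gdist_triangle x y z : (gdist x z <= gdist x y + gdist y z)%N.
Proof.
apply: gdist_le; have /has_walkP[p <- [xp py]] := has_walk_gdist x y.
have /has_walkP[q <- [yq qz]] := has_walk_gdist y z.
apply/has_walkP; exists (p ++ q); first by rewrite size_cat.
by rewrite cat_path last_cat py xp yq.
Qed.

Lemma gdist_sym x y : gdist x y = gdist y x.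
Proof.
have H (u v : vertices G) : (gdist u v <= gdist v u)%N.
  apply: gdist_le; have /has_walkP[p <- [vp pu]] := has_walk_gdist v u.
  apply/has_walkP; exists (rev (belast v p)); first by rewrite size_rev size_belast.
  split.
    by rewrite -pu rev_path (eq_path (e' := @adj G))// => a b; exact: adj_sym.
  by case: p pu {vp} => //= a p _; rewrite rev_cons last_rcons.
by apply/eqP; rewrite eqn_leq !H.
Qed.

Definition nball (n : nat) : set (vertices G) :=
  [set x | (gdist (Defs.root G) x <= n)%N].

Lemma finite_nball n : finite_set (nball n).
Proof. exact: finite_gdist. Qed.

Lemma nball_subset m n : (m <= n)%N -> nball m `<=` nball n.
Proof. by move=> mn x /= xm; exact: leq_trans mn. Qed.

Lemma nball_self x : nball (gdist (Defs.root G) x) x.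
Proof. by rewrite /nball/=. Qed.

Lemma compact_nball (K : set (vertices G)) : compact K ->
  exists n, K `<=` nball n.
Proof.
move/compact_near_coveringP => /(_ nat \oo (fun n => nball n)) H.
have [|n _ /(_ n)] := H _.
  move=> x Kx; exists ([set x], [set n | (gdist (Defs.root G) x <= n)%N]) => /=.
    split; first by rewrite nbhs_principalE; exact/principal_filterP.
    by exists (gdist (Defs.root G) x).
  by move=> [_ n] /= [-> xn].
by move=> Hn; exists n; apply: Hn => /=.
Qed.

Definition hits (A : set (vertices G)) n := A `&` nball n !=set0.

Lemma hits_leq m n A : (m <= n)%N -> hits A m -> hits A n.
Proof. by move=> mn [x [Ax xm]]; exists x; split=> //; exact: nball_subset xm. Qed.

Lemma hits_ex A : A !=set0 -> exists n, hits A n.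
Proof. by move=> [x Ax]; exists (gdist (Defs.root G) x), x; split => //=; exact: nball_self. Qed.

Definition agree n (A B : set (vertices G)) := forall x, nball n x -> A x = B x.

Lemma agree_leq m n A B : (m <= n)%N -> agree n A B -> agree m A B.
Proof. by move=> mn AB x /(nball_subset mn); exact: AB. Qed.

Lemma agree_hits m n A B : (m <= n)%N -> agree n A B -> hits A m -> hits B m.
Proof.
move=> mn /(agree_leq mn) AB [x [Ax xm]]; exists x; split => //.
by rewrite -AB.
Qed.

Lemma closed_ne_inj (E F : closed_ne (vertices G)) :
  closed_ne_set E = closed_ne_set F -> E = F.
Proof.
case: E F => [E cE E0] [F cF F0] /= EF; subst F.
by rewrite (Prop_irrelevance cE cF) (Prop_irrelevance E0 F0).
Qed.

(** Missing a compact [K] is decided on any ball that contains [K], and hitting an open set is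
    witnessed by one vertex; each subbasic condition is therefore local. *)
Lemma fell_nbhs (F : closed_ne (vertices G)) (U : set (closed_ne (vertices G))) :
  nbhs F U -> exists n, forall E : closed_ne (vertices G), agree n F E -> U E.
Proof.
rewrite nbhsE => -[B [oB BF] BU].
have [||C|n Hn] := @open_subbase_filter_base _ (@fell_subbase (vertices G))
    (fun n => [set E : closed_ne (vertices G) | agree n F E]) F _ _ _ B oB BF.
- by [].
- by move=> m n mn E; exact: agree_leq.
- move=> [[K cK <-]|[V oV <-]] /=.
    move=> FK; have [n Kn] := compact_nball cK.
    exists n => E FE; rewrite -FK; apply/seteqP; split=> x [].
      by move=> Ex Kx; split => //; rewrite FE//; exact: Kn.
    by move=> Ex Kx; split => //; rewrite -FE//; exact: Kn.
  move=> [x [Fx Vx]]; exists (gdist (Defs.root G) x) => E FE; exists x; split => //.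
  by rewrite -FE//; exact: nball_self.
by exists n => E FE; apply/BU/Hn.
Qed.

End balls.

(** * Vague neighborhoods *)

(** Every [F] hits some ball, and hitting that ball is an open condition because balls are open in
    the discrete topology. Compactness of the support then gives one radius. *)
Lemma test_function_support (R : realType) (G : rooted_graph)
    (f : closed_ne (vertices G) -> R) : test_function f ->
  exists n, forall F, f F != 0 -> hits F n.
Proof.
move=> [_ /compact_near_coveringP /(_ nat \oo (fun n F => hits F n))].
case=> [F _|n _ /(_ n (leqnn n)) H]; last first.
  by exists n => F fF; apply: H; exact: subset_closure.
have [m Hm] := hits_ex (closed_ne_nonempty F).
exists ([set E : closed_ne (vertices G) | hits E m], [set n | (m <= n)%N]) => /=.
  split; last by exists m.
  rewrite nbhsE; exists [set E : closed_ne (vertices G) | E `&` nball m !=set0] => //.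
  split => //; exists [set [set E : closed_ne (vertices G) | E `&` nball m !=set0]].
    move=> _ ->; exists [fset [set E : closed_ne (vertices G) |
        E `&` nball m !=set0]]%fset; last by rewrite set_fset1 bigcap_set1.
    move=> A /fset1P ->; rewrite inE; right.
    by exists (nball m) => //; exact: discrete_open.
  by rewrite bigcup_set1.
by move=> [E n] /= [Em mn]; exact: hits_leq Em.
Qed.

Section codes.
Variables (R : realType) (G : rooted_graph).
Implicit Types (s : nat -> set (vertices G)) (c : point_measure G).
Implicit Types (A : set (vertices G)) (f : closed_ne (vertices G) -> R).
Variable L : nat -> nat.

(* Near the ball of radius k, c is \sum_(i < L k) \delta_(s i), where indices
   with [s i] empty do not contribute. *)
Definition codes s c k :=
  (forall i, hits (s i) k -> (i < L k)%N) /\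
  (forall F : closed_ne (vertices G), hits F k ->
     c F = (\sum_(0 <= i < L k) `[< s i = F >])%N).

Lemma finite_coded s n :
  finite_set [set F : closed_ne (vertices G) | exists2 i, (i < n)%N & s i = F].
Proof.
(* The whole vertex set is a dummy value for empty [A]; only the values at nonempty [s i] are
   needed. *)
pose g A := if pselect (A !=set0) is left A0
  then ClosedNe (@discrete_closed (vertices G) A) A0
  else ClosedNe (@discrete_closed (vertices G) setT) (ex_intro _ (Defs.root G) Logic.I).
apply: (@sub_finite_set _ _ ((g \o s) @` `I_n)); last first.
  by apply: finite_image; exact: finite_II.
move=> F [i iJ siF]; exists i => //=; rewrite siF /g.
case: pselect => [F0|/(_ (closed_ne_nonempty F))//].
exact: closed_ne_inj.
Qed.
(** The empty set is the point at infinity of the locally compact Fell space; a test function has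
    compact support, so the value 0 there is its continuous extension. *)
Definition extend_set0 (f : closed_ne (vertices G) -> R) (A : set (vertices G)) : R :=
  if pselect (A !=set0) is left A0
  then f (ClosedNe (@discrete_closed (vertices G) A) A0) else 0.

Lemma extend_set0E f (F : closed_ne (vertices G)) : extend_set0 f F = f F.
Proof.
rewrite /extend_set0; case: pselect => [F0|/(_ (closed_ne_nonempty F))//].
by congr f; exact: closed_ne_inj.
Qed.

Lemma extend_set00 f A : ~ (A !=set0) -> extend_set0 f A = 0.
Proof. by rewrite /extend_set0; case: pselect. Qed.

(** The sums over closed sets and over indices are exchanged: a nonempty [s i] selects exactly one
    closed set, and an empty one contributes 0 on both sides. *)
Lemma pm_integral_codes f n s c : (forall F, f F != 0 -> hits F n) ->
  codes s c n -> pm_integral c f = \sum_(0 <= i < L n) extend_set0 f (s i).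
Proof.
move=> fn [sJ cE]; rewrite /pm_integral.
have cfE F : (c F)%:R * f F = \sum_(0 <= i < L n) `[< s i = F >]%:R * f F.
  have [->|/fn /cE ->] := eqVneq (f F) 0.
    by rewrite mulr0 big1// => i _; rewrite mulr0.
  by rewrite natr_sum mulr_suml.
have finA := finite_coded s (L n).
rewrite (fsbigTE (fset_set [set F : closed_ne (vertices G) |
    exists2 i, (i < L n)%N & s i = F])); last first.
  move=> F; rewrite in_fset_set// notin_setE /= => FJ.
  rewrite cfE big_nat big1// => i iJ.
  by case: asboolP => [siF|]; [exfalso; apply: FJ; exists i|rewrite mul0r].
under eq_bigr do rewrite cfE.
rewrite exchange_big/= big_nat [RHS]big_nat; apply: eq_bigr => i /= iJ.
have [si0|si0] := pselect (s i !=set0); last first.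
  rewrite extend_set00// big1// => F _.
  case: asboolP => [siF|]; rewrite ?mul0r//.
  by exfalso; apply: si0; rewrite siF; exact: closed_ne_nonempty.
pose F := ClosedNe (@discrete_closed (vertices G) (s i)) si0.
rewrite (bigD1_seq F)/=; last 2 first.
- by rewrite in_fset_set// inE/=; exists i.
- exact: fset_uniq.
rewrite asboolT// mul1r -[s i]/(closed_ne_set F) extend_set0E big1 ?addr0// => E EF.
case: asboolP => [siE|]; rewrite ?mul0r//.
by move: EF; rewrite (_ : E = F) ?eqxx//; exact: closed_ne_inj.
Qed.

(** The integral of a test function is a sum of [L n] terms, with the same [L] for [c] and [c'], and
    each term varies little when the trace of its cell on a large ball is kept. Finitely many
    indices then need only one radius [m]. *)
Lemma vague_nbhs_codes s c (O : set (vague R G)) :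
    (forall k, codes s c k) -> open O -> O c ->
  exists m, forall s' c', (forall k, (k <= m)%N -> codes s' c' k) ->
    (forall k, (k <= m)%N -> forall i, (i < L k)%N -> agree m (s i) (s' i)) -> O c'.
Proof.
move=> sc oO Oc.
pose near m c' := exists2 s', forall k, (k <= m)%N -> codes s' c' k &
    forall k, (k <= m)%N -> forall i, (i < L k)%N -> agree m (s i) (s' i).
have near_leq m n c' : (m <= n)%N -> near n c' -> near m c'.
  move=> mn [s' s'c' ss']; exists s' => [k km|k km i iJ].
    by apply: s'c'; exact: leq_trans mn.
  by apply: (agree_leq mn); apply: (ss' k) => //; exact: leq_trans mn.
have [||A|m Hm] := @open_subbase_filter_base _ (@vague_subbase R G)
    near c _ _ _ O oO Oc.
- by [].
- by move=> m n mn c'; exact: near_leq.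
- move=> [f [U [tf oU ->]]] /= Uc.
  have [n fn] := test_function_support tf.
  have /nbhs_ballP[e /= e0 eU] : nbhs (pm_integral c f) U by exact: open_nbhs_nbhs.
  (* The successor makes [K] positive and the total error, at most [L n] times [e / K], strictly
     less than [e]. *)
  pose K := (L n).+1%:R : R.
  have K0 : 0 < K by rewrite ltr0n.
  have Hi i : exists m, forall A, agree m (s i) A -> hits A n ->
      `|extend_set0 f (s i) - extend_set0 f A| <= e / K.
    (* If [s i] is empty, a set with the same trace on [nball n] cannot hit that ball, so the radius
       [n] makes the claim vacuous. *)
    have [si0|si0] := pselect (s i !=set0); last first.
      exists n => B sB Bn; exfalso; apply: si0.
      suff [x [sx _]] : hits (s i) n by exists x.
      apply: (agree_hits (leqnn n) _ Bn) => x xn.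
      by rewrite sB.
    pose F := ClosedNe (@discrete_closed (vertices G) (s i)) si0.
    have [m Hm] : exists m, forall E : closed_ne (vertices G),
        agree m F E -> `|f F - f E| < e / K.
      apply: (@fell_nbhs _ F [set E | `|f F - f E| < e / K]).
      have /cvgrPdist_lt := tf.1 F; apply.
      by rewrite divr_gt0.
    exists m => B sB [x [Bx _]].
    pose E := ClosedNe (@discrete_closed (vertices G) B) (ex_intro _ x Bx).
    rewrite -[s i]/(closed_ne_set F) -[B]/(closed_ne_set E) !extend_set0E.
    by apply/ltW/Hm.
  have /choice[h hE] := Hi.
  pose m := maxn n (\max_(i < L n) h i).
  exists m => c' [s' s'c' ss'].
  apply: eU; rewrite /ball/=.
  rewrite (pm_integral_codes fn (sc n)).
  rewrite (pm_integral_codes fn (s'c' n (leq_maxl _ _))).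
  rewrite -sumrB.
  apply: le_lt_trans (ler_norm_sum _ _ _) _.
  apply: (@le_lt_trans _ _ (\sum_(0 <= i < L n) e / K)); last first.
    rewrite big_const_nat subn0 iter_addr addr0 -mulr_natr mulrAC.
    by rewrite ltr_pdivrMr// ltr_pM2l// ltr_nat.
  rewrite big_nat [leRHS]big_nat; apply: ler_sum => i /= iJ.
  have ssi : agree m (s i) (s' i) by apply: (ss' n) => //; exact: leq_maxl.
  (* If [s' i] misses [nball n], so does [s i], and both terms vanish because [f] is supported on
     sets hitting that ball. *)
  have [s'n|s'n] := pselect (hits (s' i) n).
    apply: hE => //; apply: agree_leq ssi.
    rewrite leq_max; apply/orP; right.
    exact: (leq_bigmax (F := fun i : 'I_(L n) => h i) (Ordinal iJ)).
  have fN B : ~ hits B n -> extend_set0 f B = 0.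
    move=> Bn; rewrite /extend_set0; case: pselect => // B0.
    by apply: contra_notP Bn => /eqP/fn.
  rewrite !fN ?subrr ?normr0 ?divr_ge0 ?(ltW e0) ?(ltW K0)//.
  by apply: contra_not s'n; exact: agree_hits (leq_maxl _ _) ssi.
by exists m => s' c' s'c' ss'; apply: Hm; exists s'.
Qed.

End codes.

(** * Voronoi cells *)

Section voronoi.
Variable G : rooted_graph.
Implicit Types (Z : vertices G -> nat) (x y : vertices G).

Definition occupied Z r := exists2 x, nball r x & (0 < Z x)%N.

Definition same_on n Z Z' := forall x : vertices G, nball n x -> Z' x = Z x.

Lemma same_onC n Z Z' : same_on n Z Z' -> same_on n Z' Z.
Proof. by move=> ZZ' x xn; rewrite ZZ'. Qed.

Lemma same_on_leq m n Z Z' : (m <= n)%N -> same_on n Z Z' -> same_on m Z Z'.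
Proof. by move=> mn ZZ' x /(nball_subset mn)/ZZ'. Qed.

Lemma occupied_same r n Z Z' : (r <= n)%N -> same_on n Z Z' ->
  occupied Z r -> occupied Z' r.
Proof. by move=> rn ZZ' [x xr Zx]; exists x; rewrite // ZZ'//; exact: nball_subset xr. Qed.

Lemma gdist_occupied Z r k x y : occupied Z r -> nball k y -> cell Z x y ->
  (gdist y x <= k + r)%N.
Proof.
move=> [x0 x0r Zx0] yk /(_ _ Zx0) /leq_trans; apply.
apply: leq_trans (gdist_triangle _ (Defs.root G) _) _.
by rewrite gdist_sym leq_add.
Qed.

Lemma hits_cell Z r k x : occupied Z r -> hits (cell Z x) k -> nball (r + k.*2) x.
Proof.
move=> Zr [y [xy yk]]; rewrite /nball/=.
apply: leq_trans (gdist_triangle _ y _) _.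
apply: leq_trans (leq_add yk (gdist_occupied Zr yk xy)) _.
by rewrite addnA addnn addnC.
Qed.

Lemma agree_cell Z Z' r k x : occupied Z r -> same_on (r + k.*2) Z Z' ->
  agree k (cell Z x) (cell Z' x).
Proof.
move=> Zr ZZ' y yk.
have H Z1 Z2 : occupied Z1 r -> same_on (r + k.*2) Z1 Z2 ->
    cell Z1 x y -> cell Z2 x y.
  move=> Z1r Z12 xy x' Z2x'.
  (* A point outside the ball of radius [r + k.*2] is farther than [k + r] from [y], so it cannot
     compete with the occupied point of [nball r]. *)
  have [x'r|rx'] := leqP (gdist (Defs.root G) x') (r + k.*2).
    by apply: xy; rewrite -Z12.
  apply: leq_trans (gdist_occupied Z1r yk xy) _.
  have := leq_trans rx' (gdist_triangle _ y _).
  by move: yk; rewrite /nball/=; lia.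
apply/propext; split; apply: H => //; last exact: same_onC.
exact: occupied_same (leq_addr _ _) ZZ' Zr.
Qed.

(* Ordered by distance to the origin, so that the points whose cells meet a
   given ball form an initial segment of bounded length. *)
Fixpoint ball_seq N : seq (vertices G) :=
  if N is n.+1 then ball_seq n ++ fset_set (nball n.+1 `\` nball n)
  else fset_set (@nball G 0).

Lemma mem_ball_seq N x : (x \in ball_seq N) = (gdist (Defs.root G) x <= N)%N.
Proof.
elim: N => /= [|N IH].
  by rewrite in_fset_set; [|exact: finite_nball]; apply/idP/idP; rewrite inE.
rewrite mem_cat IH in_fset_set; last by apply: finite_setD; exact: finite_nball.
apply/orP/idP => [[/leqW//|]|xN].
  by rewrite inE => -[].
have [|Nx] := leqP (gdist (Defs.root G) x) N; [by left|right].
by rewrite inE; split => //; apply/negP; rewrite -ltnNge.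
Qed.

Lemma ball_seq_uniq N : uniq (ball_seq N).
Proof.
elim: N => /= [|N IH]; first exact: fset_uniq.
rewrite cat_uniq IH fset_uniq andbT /=; apply/hasPn => x.
rewrite in_fset_set; last by apply: finite_setD; exact: finite_nball.
by rewrite inE mem_ball_seq => -[_ /negP].
Qed.

Definition points Z N := flatten [seq nseq (Z x) x | x <- ball_seq N].

Lemma big_points (T : Type) (idx : T) (op : Monoid.law idx) Z N (F : vertices G -> T) :
  \big[op/idx]_(x <- points Z N) F x =
  \big[op/idx]_(x <- ball_seq N) iter (Z x) (op (F x)) idx.
Proof.
rewrite big_flatten/= big_map; apply: eq_bigr => x _.
by rewrite big_nseq.
Qed.

Lemma size_points Z N : size (points Z N) = points_in Z (@nball G N).
Proof.
rewrite /points_in (fsbig_fwiden (ball_seq N)); last 3 first.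
- by move=> x xN /=; rewrite mem_ball_seq.
- exact: ball_seq_uniq.
- by move=> x [/= + /negP]; rewrite mem_ball_seq => ->.
rewrite size_flatten /shape -map_comp sumnE big_map.
by apply: eq_bigr => x _ /=; rewrite size_nseq.
Qed.

(** Enlarging the ball only appends points, so the index of a point does not depend on the ball in
    which it is listed. *)
Lemma points_leq Z m n : (m <= n)%N ->
  exists2 t, points Z n = points Z m ++ t & {in t, forall x, ~ nball m x}.
Proof.
elim: n => [|n IH]; first by rewrite leqn0 => /eqP->; exists [::]; rewrite ?cats0.
rewrite leq_eqVlt ltnS => /predU1P[->|mn].
  by exists [::]; rewrite ?cats0.
have [t tE tm] := IH mn.
exists (t ++ flatten [seq nseq (Z x) x | x <- fset_set (nball n.+1 `\` @nball G n)]).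
  by rewrite /points/= map_cat flatten_cat catA -tE.
move=> x; rewrite mem_cat => /orP[/tm//|/flattenP[l /mapP[z zn ->]]].
rewrite mem_nseq => /andP[_ /eqP ->] zm.
move: zn; rewrite in_fset_set; last by apply: finite_setD; exact: finite_nball.
by rewrite inE => -[_]; apply; exact: nball_subset zm.
Qed.

Lemma points_same Z Z' N : same_on N Z Z' -> points Z' N = points Z N.
Proof.
move=> ZZ'; congr flatten; apply/eq_in_map => x.
by rewrite mem_ball_seq => xN; rewrite ZZ'.
Qed.

(* The cell of the i-th point of Z; it is empty if Z has at most i points. *)
Definition cells Z i : set (vertices G) :=
  [set y | exists2 N, (i < size (points Z N))%N &
                      cell Z (nth (Defs.root G) (points Z N) i) y].

Lemma nth_points Z m n i : (i < size (points Z m))%N -> (i < size (points Z n))%N ->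
  nth (Defs.root G) (points Z m) i = nth (Defs.root G) (points Z n) i.
Proof.
wlog mn : m n / (m <= n)%N => [H|im _].
  by have [/H//|/ltnW/H H1] := leqP m n => *; rewrite H1.
by have [t -> _] := points_leq Z mn; rewrite nth_cat im.
Qed.

Lemma cellsE Z N i : (i < size (points Z N))%N ->
  cells Z i = cell Z (nth (Defs.root G) (points Z N) i).
Proof.
move=> iN; apply/seteqP; split => y; last by exists N.
by move=> [n /nth_points/(_ iN) <-].
Qed.

Lemma hits_cells Z r k i : occupied Z r -> hits (cells Z i) k ->
  (i < size (points Z (r + k.*2)))%N.
Proof.
move=> Zr [y [[N iN iy] yk]].
have /(hits_cell Zr) xk : hits (cell Z (nth (Defs.root G) (points Z N) i)) k.
  by exists y.
rewrite ltnNge; apply/negP => ki.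
have [Nk|/ltnW/(points_leq Z)[t tE tr]] := leqP N (r + k.*2).
  have [t tE _] := points_leq Z Nk.
  by move: ki; rewrite tE size_cat leqNgt => /negP; apply; exact: ltn_addr.
move: xk iN; rewrite tE nth_cat ltnNge ki/= size_cat => xk iN.
by apply: tr xk; apply: mem_nth; rewrite ltn_subLR.
Qed.

Lemma agree_cells Z Z' r k i : occupied Z r -> same_on (r + k.*2) Z Z' ->
  agree k (cells Z i) (cells Z' i).
Proof.
move=> Zr ZZ'.
have Z'r := occupied_same (leq_addr _ _) ZZ' Zr.
have [iZ|Zi] := ltnP i (size (points Z (r + k.*2))).
  rewrite (cellsE iZ) (@cellsE Z' (r + k.*2)); rewrite (points_same ZZ')//.
  exact: agree_cell Zr ZZ'.
(* Beyond the initial segment both traces on [nball k] are empty. *)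
move=> y yk; apply/propext; split => iy; exfalso.
  have /(hits_cells Zr) : hits (cells Z i) k by exists y.
  by rewrite ltnNge Zi.
have /(hits_cells Z'r) : hits (cells Z' i) k by exists y.
by rewrite (points_same ZZ') ltnNge Zi.
Qed.

(** Indices past the points of the ball of radius [r + k.*2] have cells that miss [nball k], so they
    never equal [F]. Grouping the remaining indices by vertex recovers the multiplicities of
    [vor Z]. *)
Lemma vor_codes (L : nat -> nat) Z r k : occupied Z r ->
  (size (points Z (r + k.*2)) <= L k)%N -> codes L (cells Z) (vor Z) k.
Proof.
move=> Zr ZL; split=> [i /(hits_cells Zr)/leq_trans|F Fk]; first exact.
rewrite (big_cat_nat (n := size (points Z (r + k.*2))))//=.
rewrite [X in (_ + X)%N]big_nat [X in (_ + X)%N]big1 ?addn0; last first.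
  move=> i /andP[ri _]; case: asboolP => // iF; exfalso.
  have := @hits_cells Z r k i Zr; rewrite iF => /(_ Fk).
  by rewrite ltnNge ri.
transitivity (\sum_(x <- points Z (r + k.*2)) `[< cell Z x = F >] : nat)%N; last first.
  rewrite (big_nth (Defs.root G)) big_nat [RHS]big_nat; apply: eq_bigr => i /andP[_ ir].
  by rewrite (cellsE ir).
rewrite big_points /= /vor_mult.
rewrite (_ : [set x | _] = [set` fun x => `[< vor_cell Z x = F >]]); last first.
  by apply/seteqP; split=> x /asboolP.
rewrite -(@bigfs _ _ _ _ (ball_seq (r + k.*2))); last 2 first.
- exact: ball_seq_uniq.
- move=> x /asboolP xF; rewrite mem_ball_seq => xr.
  exfalso; move: xr => /negP; apply; apply: (hits_cell Zr).
  by rewrite -[cell Z x]/(closed_ne_set (vor_cell Z x)) xF.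
rewrite big_mkcond; apply: eq_bigr => x _ /=.
rewrite (_ : `[< cell Z x = F >] = `[< vor_cell Z x = F >]); last first.
  by apply: asbool_equiv_eq; split => [xF|<-//]; exact: closed_ne_inj.
by rewrite iter_addn_0; case: asbool; rewrite ?mul1n ?mul0n.
Qed.

End voronoi.

(** * Continuity and compactness *)

(** A configuration bounds its own counts, so [L] is read off from [Z]. Occupancy matters: at the
    empty configuration continuity fails, since a single point, however far, has the whole graph as
    its cell. *)
Lemma vor_continuous (R : realType) (G : rooted_graph) (Z : vertices G -> nat) r
    (O : set (vague R G)) : occupied Z r -> open O -> O (vor Z) ->
  exists m, forall Z', same_on m Z Z' -> O (vor Z').
Proof.
move=> Zr oO OZ.
pose L k := size (points Z (r + k.*2)).
have [|m Hm] := @vague_nbhs_codes R G L (cells Z) (vor Z) O _ oO OZ.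
  by move=> k; exact: (vor_codes Zr (leqnn _)).
exists (r + m.*2) => Z' ZZ'.
have Z'r := occupied_same (leq_addr _ _) ZZ' Zr.
apply: (Hm (cells Z')) => k km; last by move=> i _; exact: agree_cells Zr ZZ'.
apply: vor_codes Z'r _; rewrite (points_same (same_on_leq _ ZZ'))//.
by rewrite leq_add2l leq_double.
Qed.

(** * Limits of sequences of cells along an ultrafilter *)

Section ultralimit.
Variables (G : rooted_graph) (U : set_system nat).
Hypotheses (UU : UltraFilter U) (infU : \oo `<=` U).
Variables (L : nat -> nat) (s : nat -> nat -> set (vertices G)).
Hypothesis sL : forall n k i, (k <= n)%N -> hits (s n i) k -> (i < L k)%N.

Let PU : ProperFilter U := ultra_proper.

(** One ultrafilter decides all pairs of an index and a vertex simultaneously, in place of a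
    diagonal extraction of subsequences. *)
Definition ultralim i : set (vertices G) := [set y | U [set n | s n i y]].

Lemma ultralim_eq i y : U [set n | ultralim i y = s n i y].
Proof.
have [A|A] := in_ultra_setVsetC [set n | s n i y] UU.
  by apply: filterS (A) => n siy; apply/propext; split.
apply: filterS (A) => n nsiy; apply/propext; split => // iy.
by have [k []] := @filter_ex _ U _ _ (filterI A iy).
Qed.

Lemma ultralim_agree k N : U [set n | forall i, (i < N)%N -> agree k (ultralim i) (s n i)].
Proof.
have -> : [set n | forall i, (i < N)%N -> agree k (ultralim i) (s n i)] =
    \bigcap_(i in [set` fset_set `I_N]) \bigcap_(y in [set` fset_set (@nball G k)])
      [set n | ultralim i y = s n i y].
  rewrite !fset_setK; [|exact: finite_nball|exact: finite_II].
  by apply/seteqP; split => n H i iN y yk; exact: H.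
by do 2!(apply: filter_bigI => ? _); exact: ultralim_eq.
Qed.

Lemma hits_ultralim k i : hits (ultralim i) k -> (i < L k)%N.
Proof.
move=> [y [iy yk]].
have kU : U [set n | (k <= n)%N] by apply: infU; exists k.
have [n [/= niy kn]] := @filter_ex _ U _ _ (filterI iy kU).
by apply: (sL kn); exists y.
Qed.

(** The multiplicity is read at some radius where [F] hits the ball; [ultralim_multE] shows that the
    choice of radius is immaterial. *)
Definition ultralim_mult (F : closed_ne (vertices G)) : nat :=
  (\sum_(0 <= i < L (xget 0%N [set n | hits F n])) `[< ultralim i = F >])%N.

Lemma ultralim_multE k (F : closed_ne (vertices G)) : hits F k ->
  ultralim_mult F = (\sum_(0 <= i < L k) `[< ultralim i = F >])%N.
Proof.
have trunc m n : hits F m ->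
    (\sum_(0 <= i < L m) `[< ultralim i = F >])%N =
    (\sum_(0 <= i < maxn (L m) n) `[< ultralim i = F >])%N.
  move=> Fm; rewrite [RHS](big_cat_nat (n := L m)) ?leq_maxl//=.
  rewrite [X in (_ + X)%N]big_nat [X in (_ + X)%N]big1 ?addn0// => i /andP[mi _].
  case: asboolP => // iF; exfalso; move: mi; rewrite leqNgt => /negP; apply.
  by apply: hits_ultralim; rewrite iF.
move=> Fk; rewrite /ultralim_mult; set m := xget _ _.
have Fm : hits F m by apply: (@xgetPex _ 0%N [set n | hits F n]); exists k.
by rewrite (trunc m (L k) Fm) maxnC -trunc.
Qed.

Lemma ultralim_mult_locally_finite (K : set (vertices G)) : finite_set K ->
  finite_set [set F | ultralim_mult F <> 0%N /\ F `&` K !=set0].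
Proof.
move=> /finite_compact/compact_nball[k Kk].
apply: (@sub_finite_set _ _ _ _ (finite_coded ultralim (L k))) => F [Fc [y [Fy Ky]]].
have Fk : hits F k by exists y; split => //; exact: Kk.
apply: contrapT => H; apply: Fc; rewrite (ultralim_multE Fk) big_nat big1// => i ik.
by case: asboolP => // iF; exfalso; apply: H; exists i => //; case/andP: ik.
Qed.

Definition ultralim_pm := PointMeasure ultralim_mult_locally_finite.

Lemma ultralim_codes k : codes L ultralim ultralim_pm k.
Proof. by split=> [i|F]; [exact: hits_ultralim|exact: ultralim_multE]. Qed.

End ultralimit.

(* Compactness argument: from a sequence of counterexamples, an ultrafilter
   extracts a limiting sequence of cells, hence a limiting point measure. *)
Lemma vor_uniform (R : realType) (G : rooted_graph) (L : nat -> nat)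
    (V : vague R G -> vague R G -> Prop) :
    (forall c : vague R G, exists O : set (vague R G),
       [/\ open O, O c & forall a b, O a -> O b -> V a b]) ->
  exists n, forall r Z Z', occupied Z r ->
    (forall k, (k <= n)%N -> (size (points Z (r + k.*2)) <= L k)%N) ->
    same_on (r + n.*2) Z Z' -> V (vor Z) (vor Z').
Proof.
move=> VO; apply: contrapT => H.
have Hn n : exists rZZ' : nat * (vertices G -> nat) * (vertices G -> nat),
    [/\ occupied rZZ'.1.2 rZZ'.1.1,
      forall k, (k <= n)%N -> (size (points rZZ'.1.2 (rZZ'.1.1 + k.*2)) <= L k)%N,
      same_on (rZZ'.1.1 + n.*2) rZZ'.1.2 rZZ'.2 &
      ~ V (vor rZZ'.1.2) (vor rZZ'.2)].
  apply: contrapT => Hn; apply: H; exists n => r Z Z' Zr ZL ZZ'.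
  by apply: contrapT => ZV; apply: Hn; exists (r, Z, Z').
have {H Hn} /choice[F FP] := Hn.
(* The radii [r n] may be unbounded, so no limit of the configurations [Z n] is sought; only their
   cells are passed to the limit. *)
pose r n := (F n).1.1; pose Z n := (F n).1.2; pose Z' n := (F n).2.
have [U [UU infU]] := ultraFilterLemma (_ : ProperFilter \oo).
have Zr n : occupied (Z n) (r n) by case: (FP n).
have ZL n k : (k <= n)%N -> (size (points (Z n) (r n + k.*2)) <= L k)%N.
  by case: (FP n) => _ + _ _; apply.
have ZZ' n : same_on (r n + n.*2) (Z n) (Z' n) by case: (FP n).
have Z'r n : occupied (Z' n) (r n).
  exact: occupied_same (leq_addr _ _) (ZZ' n) (Zr n).
have sL n k i : (k <= n)%N -> hits (cells (Z n) i) k -> (i < L k)%N.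
  by move=> kn /(hits_cells (Zr n))/leq_trans; apply; exact: ZL.
pose c : vague R G := ultralim_pm UU infU sL.
have [W [oW Wc WV]] := VO c.
have [m Hm] := vague_nbhs_codes (ultralim_codes UU infU sL) oW Wc.
have mU : U [set n | (m <= n)%N] by apply: (infU); exists m.
(* [N] covers every index that [vague_nbhs_codes] inspects up to radius [m], so finitely many traces
   decide, and one [n] in the ultrafilter serves them all. *)
pose N := (\max_(k < m.+1) L k)%N.
have [n [/= nN mn]] := @filter_ex _ U (ultra_proper) _
  (filterI (ultralim_agree UU (fun n => cells (Z n)) m N) mU).
have LN k i : (k <= m)%N -> (i < L k)%N -> (i < N)%N.
  move=> km ik; apply: leq_trans ik _.
  exact: (leq_bigmax (F := fun k : 'I_m.+1 => L k) (Ordinal (km : (k < m.+1)%N))).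
case: (FP n) => _ _ _; apply; apply: WV.
  apply: (Hm (cells (Z n))) => k km; last by move=> i ik; apply: nN; exact: LN km ik.
  by apply: vor_codes (Zr n) _; apply: ZL; exact: leq_trans mn.
apply: (Hm (cells (Z' n))) => k km.
  apply: vor_codes (Z'r n) _; rewrite (points_same (same_on_leq _ (ZZ' n))).
    by apply: ZL; exact: leq_trans mn.
  by rewrite leq_add2l leq_double; exact: leq_trans mn.
move=> i ik x xm; rewrite nN//; last exact: LN km ik.
exact: (agree_leq mn (agree_cells i (Zr n) (ZZ' n)) xm).
Qed.

(** * Independent counts *)

Section overlap.
Variable R : realType.
Local Open Scope ereal_scope.

(* Two laws with a common part r of mass at least 1 - delta are within total
   variation distance delta. *)
Lemma nneseries_overlap (p q r : nat -> R) (h : nat -> \bar R) (delta : R) :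
    (forall k, 0 <= r k <= p k)%R -> (forall k, r k <= q k)%R ->
    \sum_(k <oo) (p k)%:E = 1 -> 1 <= \sum_(k <oo) (r k)%:E + delta%:E ->
    (forall k, 0 <= h k <= 1) ->
  \sum_(k <oo) (p k)%:E * h k <= \sum_(k <oo) (q k)%:E * h k + delta%:E.
Proof.
move=> rp rq p1 r1 h01.
have r0 k : (0 <= r k)%R by case/andP: (rp k).
have pr0 k : (0 <= p k - r k)%R by rewrite subr_ge0; case/andP: (rp k).
have h0 k : 0 <= h k by case/andP: (h01 k).
have h1 k : h k <= 1 by case/andP: (h01 k).
have pE : \sum_(k <oo) (r k)%:E + \sum_(k <oo) (p k - r k)%:E = 1.
  rewrite -nneseriesD -?p1; last 2 first.
  - by move=> k _ _; rewrite lee_fin.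
  - by move=> k _ _; rewrite lee_fin.
  by apply: eq_eseriesr => k _; rewrite -EFinD addrC subrK.
have r_fin : \sum_(k <oo) (r k)%:E \is a fin_num.
  rewrite ge0_fin_numE; last by apply: nneseries_ge0 => k _ _; rewrite lee_fin.
  apply: (@le_lt_trans _ _ 1); last by rewrite ltry.
  by rewrite -pE leeDl// nneseries_ge0// => k _ _; rewrite lee_fin.
have prd : \sum_(k <oo) (p k - r k)%:E <= delta%:E.
  by rewrite -(leeD2lE _ _ r_fin) pE.
apply: (@le_trans _ _ (\sum_(k <oo) (r k)%:E * h k + \sum_(k <oo) (p k - r k)%:E)).
  rewrite -nneseriesD; last 2 first.
  - by move=> k _ _; rewrite mule_ge0// lee_fin.
  - by move=> k _ _; rewrite lee_fin.
  apply: lee_nneseries => [k _ _|k _].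
    by rewrite mule_ge0// lee_fin (le_trans (r0 k))//; case/andP: (rp k).
  rewrite -[in leLHS](subrK (r k) (p k)) EFinD ge0_muleDl ?lee_fin//.
  by rewrite addeC leeD2l// -[leRHS]mule1 lee_pmul// lee_fin.
apply: leeD => //; apply: lee_nneseries => [k _ _|k _].
  by rewrite mule_ge0// lee_fin.
by rewrite lee_wpmul2r// lee_fin.
Qed.

End overlap.

Section mixture.
Variables (R : realType) (T : choiceType).
Implicit Types (p q : T -> nat -> R) (g : (T -> nat) -> R) (z : T -> nat) (s : seq T).
Local Open Scope ereal_scope.

Definition upd z x k : T -> nat := fun y => if y == x then k else z y.

Definition depends_on (U : Type) s (g : (T -> nat) -> U) :=
  forall z z', {in s, z =1 z'} -> g z = g z'.

Lemma depends_on_upd (U : Type) x s (g : (T -> nat) -> U) k :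
  depends_on (x :: s) g -> depends_on s (fun z => g (upd z x k)).
Proof.
move=> gs z z' zz'; apply: gs => y; rewrite inE /upd.
by case: eqVneq => //= _; exact: zz'.
Qed.

(* The expectation of g when the coordinates x in s are independent with laws
   p x, and the others are frozen to z. *)
Fixpoint mixture p g s z : \bar R :=
  if s is x :: s' then \sum_(k <oo) (p x k)%:E * mixture p g s' (upd z x k)
  else (g z)%:E.

Definition pmfs p := forall x,
  (forall k, 0 <= p x k)%R /\ \sum_(k <oo) (p x k)%:E = 1.

Lemma mixture_01 p g s z : pmfs p -> (forall z, 0 <= g z <= 1)%R ->
  0 <= mixture p g s z <= 1.
Proof.
move=> p1 g01; elim: s z => [z|x s IH z] /=; first by rewrite !lee_fin.
have [p0 <-] := p1 x.
apply/andP; split.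
  apply: nneseries_ge0 => k _ _; rewrite mule_ge0 ?lee_fin//.
  by case/andP: (IH (upd z x k)).
apply: lee_nneseries => k _; have /andP[m0 m1] := IH (upd z x k).
  by move=> _; rewrite mule_ge0 ?lee_fin.
by rewrite -[leRHS]mule1 lee_pmul// lee_fin.
Qed.

(** The laws are exchanged one coordinate at a time. With the other coordinates averaged out, the
    mixture is a function of the current one with values in [0,1], hence an admissible [h], and the
    errors add up. *)
Lemma mixture_le p q g s z (delta : T -> R) : pmfs p -> pmfs q ->
    (forall z, 0 <= g z <= 1)%R -> (forall x, 0 <= delta x)%R ->
    (forall x (h : nat -> \bar R), (forall k, 0 <= h k <= 1) ->
      \sum_(k <oo) (p x k)%:E * h k <= \sum_(k <oo) (q x k)%:E * h k + (delta x)%:E) ->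
  mixture p g s z <= mixture q g s z + (\sum_(x <- s) delta x)%:E.
Proof.
move=> p1 q1 g01 d0 pq; elim: s z => [z|x s IH z] /=; first by rewrite big_nil adde0.
have [px0 px1] := p1 x.
have m01 k := mixture_01 s (upd z x k) q1 g01.
have m0 k : 0 <= mixture q g s (upd z x k) by case/andP: (m01 k).
have D0 : (0 <= \sum_(y <- s) delta y)%R by exact: sumr_ge0.
apply: (@le_trans _ _ (\sum_(k <oo) (p x k)%:E * mixture q g s (upd z x k) +
    \sum_(k <oo) (\sum_(y <- s) delta y)%:E * (p x k)%:E)).
  rewrite -nneseriesD; last 2 first.
  - by move=> k _ _; rewrite mule_ge0// lee_fin.
  - by move=> k _ _; rewrite mule_ge0// lee_fin.
  apply: lee_nneseries => [k _ _|k _].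
    by rewrite mule_ge0// ?lee_fin//; case/andP: (mixture_01 s (upd z x k) p1 g01).
  rewrite [in leRHS]muleC [X in _ + X]muleC [X in X + _]muleC -ge0_muleDr// ?lee_fin//.
  by rewrite lee_wpmul2l// lee_fin.
rewrite nneseriesZl ?px1 ?mule1//; last by move=> k _; rewrite lee_fin.
rewrite big_cons EFinD addeA leeD2r//; exact: pq.
Qed.

End mixture.

Section independent_counts.
Variables (R : realType) (T : choiceType).
Variables (d : measure_display) (Om : measurableType d) (P : probability Om R).
Variables (X : Om -> T -> nat).
Local Open Scope ereal_scope.

Hypothesis mX : forall x k, measurable [set w | X w x = k].

(** Induction on the coordinates, splitting along the countably many values of each. *)
Lemma measurable_depends_on s (A : set (T -> nat)) : depends_on s A ->
  measurable [set w | A (X w)].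
Proof.
elim: s A => [|x s IH] A As.
  have [[z Az]|A0] := pselect (A !=set0).
    by rewrite (_ : [set w | _] = setT)//; apply/seteqP; split => // w _ /=; rewrite (As _ z).
  rewrite (_ : [set w | _] = set0)//; apply/seteqP; split => // w /= Aw.
  by apply: A0; exists (X w).
rewrite (_ : [set w | _] =
    \bigcup_k ([set w | X w x = k] `&` [set w | A (upd (X w) x k)])).
  apply: bigcupT_measurable => k; apply: measurableI => //.
  by apply: (IH (fun z => A (upd z x k))); exact: depends_on_upd.
have updX w : upd (X w) x (X w x) = X w.
  by apply/funext => y; rewrite /upd; case: eqVneq => // ->.
apply/seteqP; split => w /=.
  by move=> Aw; exists (X w x) => //; split => //=; rewrite updX.
by move=> [k _ [/= <-]]; rewrite updX.
Qed.

Lemma measurable_fun_depends_on s (g : (T -> nat) -> R) : depends_on s g ->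
  measurable_fun setT (fun w => (g (X w))%:E).
Proof.
move=> gs _ Y _; rewrite setTI.
apply: (measurable_depends_on (s := s) (A := [set z | Y (g z)%:E])) => z z' zz' /=.
by rewrite (gs _ _ zz').
Qed.

Variable p : T -> nat -> R.
Hypothesis PX : forall s z, uniq s ->
  P (\bigcap_(x in [set` s]) [set w | X w x = z x]) = \prod_(x <- s) (p x (z x))%:E.

Let pE x k : P [set w | X w x = k] = (p x k)%:E.
Proof.
have := PX (fun=> k) (isT : uniq [:: x]); rewrite big_seq1 => <-; congr (P _).
by apply/seteqP; split => w /= H => [y /=|]; [rewrite inE => /eqP->|apply: H; rewrite /= inE].
Qed.

Lemma pmfs_independent : pmfs p.
Proof.
move=> x; split => [k|]; first by rewrite -lee_fin -pE.
under eq_eseriesr do rewrite -pE.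
rewrite -(measure_semi_bigcup P (A := fun k => [set w | X w x = k]))//; last 2 first.
- apply/trivIsetP => i j _ _ ij; apply/seteqP; split => // w [/= wi wj].
  by move: ij; rewrite -wi -wj eqxx.
- exact: bigcupT_measurable.
rewrite -(probability_setT P); congr (P _).
by apply/seteqP; split => // w _; exists (X w x).
Qed.

(** The form required by induction: the coordinates in [s'] are already fixed by the event, those in
    [s] remain to be averaged. Partitioning the event by the value of [X w x] moves [x] from [s] to
    [s']. *)
Lemma integral_cylinder s s' z (g : (T -> nat) -> R) : uniq (s ++ s') ->
    depends_on (s ++ s') g -> (forall z, 0 <= g z)%R ->
  \int[P]_(w in \bigcap_(x in [set` s']) [set w | X w x = z x]) (g (X w))%:E =
  mixture p g s z * \prod_(x <- s') (p x (z x))%:E.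
Proof.
have p0 x k : (0 <= p x k)%R by rewrite -lee_fin -pE.
have mE (t : seq T) y : measurable (\bigcap_(x in [set` t]) [set w | X w x = y x]).
  by apply: fin_bigcap_measurable => [|x _]; [exact: finite_seq|exact: mX].
elim: s s' z => [|x s IH] s' z /= us gs g0.
  rewrite -(PX z us) -integral_cst//; apply: eq_integral => w.
  rewrite inE => wz; congr EFin; apply: gs => x xs.
  exact: (wz x xs).
rewrite (_ : \bigcap_(y in [set` s']) _ =
    \bigcup_k \bigcap_(y in [set` x :: s']) [set w | X w y = upd z x k y]); last first.
  have /andP[xs' _] := us.
  have xs : x \notin s' by apply: contra xs'; rewrite mem_cat => ->; rewrite orbT.
  apply/seteqP; split => w /=.
    move=> wz; exists (X w x) => // y; rewrite /= inE /upd.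
    by case: eqVneq => [->//|_ /= /wz].
  move=> [k _ wk] y ys'; have := wk y; rewrite /= inE /upd ys' orbT => /(_ isT).
  by case: eqVneq => // yx; move: ys' xs; rewrite -yx /= => ->.
rewrite ge0_integral_bigcup//; last 3 first.
- by apply: measurable_funTS; apply: (@measurable_fun_depends_on (x :: s ++ s')).
- by move=> w _; rewrite lee_fin.
- apply/trivIsetP => i j _ _ ij; apply/seteqP; split => // w [/= /(_ x) wi /(_ x) wj].
  by move: wi wj ij; rewrite /= /upd mem_head eqxx => /(_ isT) <- /(_ isT) <-; rewrite eqxx.
have pm0 y : 0 <= mixture p g s y.
  elim: s {IH us gs} y => [|a s IHs] y /=; first by rewrite lee_fin.
  by apply: nneseries_ge0 => i _ _; rewrite mule_ge0// lee_fin.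
rewrite prodEFin muleC -nneseriesZl; last by move=> k _; rewrite mule_ge0 ?lee_fin ?p0 ?pm0.
have xs' : x \notin s' by case/andP: us; rewrite mem_cat negb_or => /andP[].
apply: eq_eseriesr => k _; rewrite IH//; last 2 first.
- by rewrite uniq_catC /= mem_cat orbC -mem_cat uniq_catC; exact: us.
- move=> y y' yy'; apply: gs => a aE; apply: yy'.
  by move: aE; rewrite inE !mem_cat inE orbCA.
rewrite big_cons (_ : upd z x k x = k); last by rewrite /upd eqxx.
rewrite muleA [X in X * _]muleC muleC prodEFin; congr (_ * _).
congr EFin; rewrite big_seq [RHS]big_seq; apply: eq_bigr => y ys'.
by rewrite /upd; case: eqVneq ys' xs' => // -> ->.
Qed.

Lemma integral_mixture s z (g : (T -> nat) -> R) : uniq s ->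
    depends_on s g -> (forall z, 0 <= g z)%R ->
  \int[P]_w (g (X w))%:E = mixture p g s z.
Proof.
move=> us gs g0; have := @integral_cylinder s [::] z g.
rewrite cats0 big_nil mule1 => /(_ us gs g0) <-.
by rewrite set_nil bigcap_set0.
Qed.

End independent_counts.

(** * Poisson and Bernoulli processes *)

Section poisson_bernoulli_law.
Variable R : realType.
Implicit Types a : R.

Definition poisson_weight a k : R := expR (- a) * (a ^+ k / k`!%:R).

Definition bernoulli_weight a k : R :=
  if k is k'.+1 then if k' is 0 then a else 0 else 1 - a.

Lemma poisson_prob_set1 a k : 0 <= a ->
  poisson_prob a 0 [set k] = (poisson_weight a k)%:E.
Proof.
rewrite le_eqVlt => /predU1P[<-|a0]; rewrite /poisson_prob /poisson_weight.
  rewrite ltxx oppr0 expR0 mul1r diracE; case: k => [|k].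
    by rewrite mem_set// expr0 fact0 divr1.
  by rewrite memNset// expr0n mul0r.
rewrite a0 esum_set1; last by rewrite lee_fin poisson_pmf_ge0.
by rewrite /poisson_pmf a0 mulrC.
Qed.

Lemma poisson_weight_ge0 a k : 0 <= a -> 0 <= poisson_weight a k.
Proof. by move=> a0; rewrite mulr_ge0 ?expR_ge0// divr_ge0// exprn_ge0. Qed.

Lemma nneseries_poisson_weight a : 0 <= a ->
  (\sum_(k <oo) (poisson_weight a k)%:E = 1)%E.
Proof.
move=> a0; have := probability_setT (poisson_prob a 0).
rewrite (_ : setT = \bigcup_k [set k]); last first.
  by apply/seteqP; split => // k _; exists k.
rewrite measure_semi_bigcup//.
- by move=> <-; apply: eq_eseriesr => k _; rewrite -poisson_prob_set1.
- by apply/trivIsetP => i j _ _ /eqP ij; apply/seteqP; split => // k [/= -> /ij].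
Qed.

Lemma nneseries_01 (f : nat -> R) : (forall k, 0 <= f k) ->
  (forall k, (1 < k)%N -> f k = 0) ->
  (\sum_(k <oo) (f k)%:E = (f 0 + f 1)%:E)%E.
Proof.
move=> f0 f2; rewrite (nneseries_split 0 2)//=; last by move=> k _; rewrite lee_fin.
rewrite eseries0 ?adde0; last by move=> k /f2 ->.
by rewrite add0n big_nat_recr//= big_nat1.
Qed.

Lemma bernoulli_weight_ge0 a k : 0 <= a <= 1 -> 0 <= bernoulli_weight a k.
Proof. by move=> /andP[a0 a1]; case: k => [|[|k]] //=; rewrite subr_ge0. Qed.

Lemma nneseries_bernoulli_weight a : 0 <= a <= 1 ->
  (\sum_(k <oo) (bernoulli_weight a k)%:E = 1)%E.
Proof.
move=> a01; rewrite nneseries_01 => [|k|[|[]]//]; first by rewrite /= subrK.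
exact: bernoulli_weight_ge0.
Qed.

(** For a < 1 the common part has mass 1 - a at 0 and a exp(-a) at 1, in total at least 1 - a + a(1
    - a) = 1 - a^2. For a >= 1 the zero function suffices, as a^2 >= 1. This is the origin of the
    sum of squares. *)
Lemma poisson_bernoulli_overlap a : 0 <= a -> exists r : nat -> R,
  [/\ forall k, 0 <= r k, forall k, r k <= poisson_weight a k,
      forall k, r k <= bernoulli_weight (Num.min 1 a) k &
      (1 <= \sum_(k <oo) (r k)%:E + (a ^+ 2)%:E)%E].
Proof.
move=> a0.
have [a1|a1] := leP 1 a.
  exists (fun=> 0); split => //.
  - by move=> k; exact: poisson_weight_ge0.
  - by move=> k; apply: bernoulli_weight_ge0; rewrite ler01 lexx.
  - by rewrite eseries0 ?add0e ?lee_fin ?exprn_ege1//.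
pose r k : R := if k is k'.+1 then if k' is 0 then a * expR (- a) else 0 else 1 - a.
have r0 k : 0 <= r k.
  by case: k => [|[|k]]//=; rewrite ?subr_ge0 ?(ltW a1)// mulr_ge0// expR_ge0.
exists r; split => //.
- case=> [|[|k]] /=; last exact: poisson_weight_ge0.
    by rewrite /poisson_weight expr0 fact0 divr1 mulr1 expR_ge1Dx.
  by rewrite /poisson_weight expr1 divr1 mulrC.
- case=> [|[|k]] //=.
  by rewrite ler_piMr// -[leRHS]expR0 ler_expR oppr_le0.
- rewrite nneseries_01//; last by case=> [|[]].
  rewrite -EFinD lee_fin /=; have := expR_ge1Dx (- a) => e1.
  have : a * (1 - a) <= a * expR (- a) by rewrite ler_wpM2l.
  by rewrite mulrBr mulr1 -expr2 => ?; lra.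
Qed.

End poisson_bernoulli_law.

Section processes.
Variables (R : realType) (G : rooted_graph).
Variables (d : measure_display) (Om : measurableType d) (P : probability Om R).
Local Open Scope ereal_scope.

Lemma poisson_process_measurable nu (X : Om -> vertices G -> nat) :
  poisson_process P nu X -> forall x k, measurable [set w | X w x = k].
Proof.
move=> [mX _ _] x k; have := mX x measurableT [set k]; rewrite setTI; exact.
Qed.

Lemma points_in_set1 (Z : vertices G -> nat) x : points_in Z [set x] = Z x.
Proof. exact: fsbig_set1. Qed.

Lemma poisson_process_independent nu (X : Om -> vertices G -> nat) :
    poisson_process P nu X -> (forall x, 0 <= nu [set x]) ->
  forall (s : seq (vertices G)) z, uniq s ->
  P (\bigcap_(x in [set` s]) [set w | X w x = z x]) =
  \prod_(x <- s) (poisson_weight (fine (nu [set x])) (z x))%:E.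
Proof.
move=> [_ XP Xind] nu0 s z us; pose x0 := Defs.root G.
have := Xind (size s) (fun i => [set nth x0 s i]) (fun i => finite_set1 _).
have tA : trivIset [set: 'I_(size s)] (fun i : 'I_(size s) => [set nth x0 s i]).
  apply/trivIsetP => i j _ _ ij; apply/seteqP; split => // x [/= -> /eqP].
  by rewrite nth_uniq// => /eqP/val_inj/eqP; rewrite (negbTE ij).
move=> /(_ tA (fun i => [set z (nth x0 s i)])) => H.
transitivity (P (\bigcap_(i in [set: 'I_(size s)])
    [set w | [set z (nth x0 s i)] (points_in (X w) [set nth x0 s i])])).
  congr (P _); apply/seteqP; split => w /= wz.
    by move=> i _ /=; rewrite points_in_set1; apply: wz; rewrite /= mem_nth.
  move=> x /(nthP x0)[i si <-]; have := wz (Ordinal si) Logic.I.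
  by rewrite /= points_in_set1.
rewrite H (big_nth x0) big_mkord; apply: eq_bigr => i _.
by rewrite XP// poisson_prob_set1// fine_ge0.
Qed.

Lemma bernoulli_process_measurable (a : vertices G -> R) (S : Om -> set (vertices G)) :
  bernoulli_process P a S ->
  forall x k, measurable [set w | multiset_of (S w) x = k].
Proof.
move=> [mS _ _] x k; rewrite /multiset_of.
case: k => [|[|k]].
- rewrite (_ : [set w | _] = ~` [set w | S w x]); first exact: measurableC.
  apply/seteqP; split => w /=; first by case: (boolP (x \in S w)) => //; rewrite notin_setE.
  by move=> ?; rewrite memNset.
- rewrite (_ : [set w | _] = [set w | S w x])//.
  apply/seteqP; split => w /=; first by case: (boolP (x \in S w)) => //; rewrite inE.
  by move=> ?; rewrite mem_set.
- by rewrite (_ : [set w | _] = set0)//; apply/seteqP; split => w //=; case: (_ \in _).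
Qed.

(** The definition only prescribes the probability that given vertices are all occupied; vacancies
    follow by inclusion-exclusion. The induction carries a list [t] of vertices required to be
    occupied, and a vacancy at [x] is the difference of the cases [t] and [x :: t]. *)
Lemma bernoulli_process_independent (a : vertices G -> R) (S : Om -> set (vertices G)) :
    bernoulli_process P a S ->
  forall (s : seq (vertices G)) z, uniq s ->
  P (\bigcap_(x in [set` s]) [set w | multiset_of (S w) x = z x]) =
  \prod_(x <- s) (bernoulli_weight (a x) (z x))%:E.
Proof.
move=> bS s z us; have [mS Sa Sind] := bS.
have mZ := bernoulli_process_measurable bS.
suff H t : uniq (t ++ s) ->
    P (\bigcap_(x in [set` t]) [set w | S w x] `&`
       \bigcap_(x in [set` s]) [set w | multiset_of (S w) x = z x]) =
    \prod_(x <- t) (a x)%:E * \prod_(x <- s) (bernoulli_weight (a x) (z x))%:E.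
  by have := H [::] us; rewrite set_nil bigcap_set0 setTI big_nil mul1e.
elim: s t {us} => [|x s IH] t uts.
  rewrite set_nil bigcap_set0 setIT big_nil mule1.
  have := Sind [fset x | x in t]%fset; rewrite (_ : [set` _] = [set` t]); last first.
    by apply/seteqP; split => x /=; rewrite inE.
  move=> ->; under eq_bigr do rewrite Sa.
  apply: perm_big; apply: uniq_perm => //; first by move: uts; rewrite cats0.
  by move=> x; rewrite inE.
pose A := \bigcap_(y in [set` t]) [set w | S w y].
pose C := \bigcap_(y in [set` s]) [set w | multiset_of (S w) y = z y].
have bigcap_cons (F : vertices G -> set Om) y (l : seq (vertices G)) :
    \bigcap_(u in [set` y :: l]) F u = F y `&` \bigcap_(u in [set` l]) F u.
  apply/seteqP; split => w H.
    by split=> [|u ul]; apply: H; rewrite /= ?mem_head// inE ul orbT.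
  by move=> u; rewrite /= inE => /predU1P[->|]; [exact: H.1|exact: H.2].
have mA : measurable A by apply: fin_bigcap_measurable => [|y _]; [exact: finite_seq|].
have mC : measurable C by apply: fin_bigcap_measurable => [|y _]; [exact: finite_seq|].
have uxts : uniq (x :: t ++ s) by rewrite (perm_uniq (permEl (perm_catCA [:: x] t s))).
have uts' : uniq (t ++ s) by case/andP: uxts.
have := IH (x :: t) uxts; rewrite !bigcap_cons -/A -/C => IHx.
have := IH t uts'; rewrite -/A -/C => IHt.
rewrite big_cons; case zx : (z x) => [|[|k]] /=.
- rewrite (_ : A `&` _ = (A `&` C) `\` [set w | S w x]); last first.
    apply/seteqP; split => w /=; rewrite /multiset_of.
      by move=> [Aw []]; case: (boolP (x \in S w)) => //; rewrite notin_setE.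
    by move=> [[Aw Cw] Sx]; split => //; split => //; rewrite memNset.
  transitivity (P (A `&` C) - P (A `&` C `&` [set w | S w x])).
    apply: measureD => //; first exact: measurableI.
    by rewrite (le_lt_trans (probability_le1 _ _))// ?ltry//; exact: measurableI.
  rewrite [X in _ - P X]setIC setIA IHx IHt big_cons !prodEFin -!EFinM -EFinB.
  by congr EFin; ring.
- rewrite (_ : A `&` _ = [set w | S w x] `&` A `&` C).
    by rewrite IHx big_cons !muleA [in LHS](muleC (a x)%:E).
  apply/seteqP; split => w /=; rewrite /multiset_of.
    by move=> [Aw []]; case: (boolP (x \in S w)) => //; rewrite inE.
  by move=> [[Sx Aw] Cw]; split => //; split => //; rewrite mem_set.
- rewrite mul0e mule0 (_ : _ `&` _ = set0) ?measure0//.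
  by apply/seteqP; split => // w [_ []] /=; rewrite /multiset_of; case: (_ \in _).
Qed.

End processes.

Section comparison.
Variables (R : realType) (G : rooted_graph).
Variables (nu : set (vertices G) -> \bar R).
Variables (dX : measure_display) (OmX : measurableType dX) (PX : probability OmX R).
Variables (dY : measure_display) (OmY : measurableType dY) (PY : probability OmY R).
Variables (X : OmX -> vertices G -> nat) (Y : OmY -> set (vertices G)).
Hypothesis nu0 : forall x, (0 <= nu [set x])%E.
Hypothesis XP : poisson_process PX nu X.
Hypothesis YB : bernoulli_process PY (fun x => Num.min 1 (fine (nu [set x])))%R Y.
Local Open Scope ereal_scope.

Let w x := fine (nu [set x]).
Let w0 x : (0 <= w x)%R. Proof. exact: fine_ge0. Qed.
Let m01 x : (0 <= Num.min 1 (w x) <= 1)%R.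
Proof. by rewrite le_min ler01 w0/= ge_min lexx. Qed.

Variables (s : seq (vertices G)) (g : (vertices G -> nat) -> R).
Hypotheses (us : uniq s) (gs : depends_on s g) (g01 : forall z, (0 <= g z <= 1)%R).

Let g0 z : (0 <= g z)%R. Proof. by case/andP: (g01 z). Qed.
Let pX : pmfs (fun x => poisson_weight (w x)).
Proof.
apply: (pmfs_independent (p := fun x => poisson_weight (w x))
  (poisson_process_measurable XP)).
exact: poisson_process_independent XP nu0.
Qed.

Let pY : pmfs (fun x => bernoulli_weight (Num.min 1 (w x))%R).
Proof.
apply: (pmfs_independent (p := fun x => bernoulli_weight (Num.min 1 (w x))%R)
  (bernoulli_process_measurable YB)).
exact: bernoulli_process_independent YB.
Qed.

Lemma poisson_le_bernoulli :
  \int[PX]_w (g (X w))%:E <=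
  \int[PY]_w (g (multiset_of (Y w)))%:E + (\sum_(x <- s) w x ^+ 2)%:E.
Proof.
rewrite (integral_mixture (p := fun x => poisson_weight (w x))
  (poisson_process_measurable XP)
  (poisson_process_independent XP nu0) (fun=> 0%N) us gs g0).
rewrite (integral_mixture (p := fun x => bernoulli_weight (Num.min 1 (w x))%R)
  (bernoulli_process_measurable YB)
  (bernoulli_process_independent YB) (fun=> 0%N) us gs g0).
apply: mixture_le => // x; first exact: sqr_ge0.
move=> h h01; have [r [r0 rp rb r1]] := poisson_bernoulli_overlap (w0 x).
apply: (nneseries_overlap _ rb _ r1 h01) => [k|]; first by rewrite r0 rp.
exact: nneseries_poisson_weight.
Qed.

Lemma bernoulli_le_poisson :
  \int[PY]_w (g (multiset_of (Y w)))%:E <=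
  \int[PX]_w (g (X w))%:E + (\sum_(x <- s) w x ^+ 2)%:E.
Proof.
rewrite (integral_mixture (p := fun x => poisson_weight (w x))
  (poisson_process_measurable XP)
  (poisson_process_independent XP nu0) (fun=> 0%N) us gs g0).
rewrite (integral_mixture (p := fun x => bernoulli_weight (Num.min 1 (w x))%R)
  (bernoulli_process_measurable YB)
  (bernoulli_process_independent YB) (fun=> 0%N) us gs g0).
apply: mixture_le => // x; first exact: sqr_ge0.
move=> h h01; have [r [r0 rp rb r1]] := poisson_bernoulli_overlap (w0 x).
apply: (nneseries_overlap _ rp _ r1 h01) => [k|]; first by rewrite r0 rb.
exact: nneseries_bernoulli_weight.
Qed.

End comparison.

(** * Local comparison of tessellations *)

Section measurability.
Variables (R : realType) (G : rooted_graph).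
Variables (d : measure_display) (Om : measurableType d).
Variable X : Om -> vertices G -> nat.
Hypothesis mX : forall x k, measurable [set w | X w x = k].

Lemma depends_on_occupied r : depends_on (ball_seq G r) (fun Z => occupied Z r).
Proof.
move=> Z Z' ZZ'; apply/propext; split => -[x xr Zx]; exists x => //.
  by rewrite -ZZ'// mem_ball_seq.
by rewrite ZZ'// mem_ball_seq.
Qed.

Lemma depends_on_leq (U : Type) m n (g : (vertices G -> nat) -> U) :
  (m <= n)%N -> depends_on (ball_seq G m) g -> depends_on (ball_seq G n) g.
Proof.
move=> mn gm z z' zz'; apply: gm => x xm; apply: zz'.
by move: xm; rewrite !mem_ball_seq => /leq_trans; apply.
Qed.

Lemma depends_on_same (m : nat) (Q : (vertices G -> nat) -> Prop) :
  depends_on (ball_seq G m) (fun Z => forall Z', same_on m Z Z' -> Q Z').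
Proof.
move=> Z1 Z2 Z12; apply/propext; split => H Z' ZZ'; apply: H => x xm; rewrite ZZ'//.
  by rewrite Z12// mem_ball_seq.
by rewrite -Z12// mem_ball_seq.
Qed.

(** By [vor_continuous], the nonempty configurations in the preimage form a countable union of
    events that depend on finitely many counts. The empty configuration is a separate event. *)
Lemma measurable_vor_open (O : set (vague R G)) : open O ->
  measurable [set w | O (vor (X w))].
Proof.
move=> oO.
pose A r m : set (vertices G -> nat) :=
  [set Z | occupied Z r /\ forall Z', same_on m Z Z' -> O (vor Z')].
have mA r m : measurable [set w | A r m (X w)].
  apply: (measurable_depends_on mX (s := ball_seq G (maxn r m))) => z z' zz'.
  rewrite /A /=; congr (_ /\ _).
    exact: (depends_on_leq (leq_maxl _ _) (@depends_on_occupied r) zz').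
  exact: (depends_on_leq (leq_maxr _ _) (@depends_on_same m (fun Z => O (vor Z))) zz').
have mocc r : measurable [set w | occupied (X w) r].
  exact: (measurable_depends_on mX (@depends_on_occupied r)).
rewrite (_ : [set w | _] = (\bigcup_r \bigcup_m [set w | A r m (X w)]) `|`
    ((\bigcap_r ~` [set w | occupied (X w) r]) `&` [set w | O (vor (fun=> 0%N))])).
  apply: measurableU; first by do 2 apply: bigcupT_measurable => ?.
  apply: measurableI; first by apply: bigcapT_measurable => r; exact: measurableC.
  have [vO|vO] := pselect (O (vor (fun=> 0%N))).
    by rewrite (_ : [set w | _] = setT)//; apply/seteqP; split.
  by rewrite (_ : [set w | _] = set0)//; apply/seteqP; split.
have Xw0 w x : ~ (exists r, occupied (X w) r) -> X w x = 0%N.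
  move=> wN; apply: contrapT => /eqP Xx; apply: wN.
  by exists (gdist (Defs.root G) x), x; [exact: nball_self|rewrite lt0n].
apply/seteqP; split => w /=.
  move=> Ow; have [[r wr]|wN] := pselect (exists r, occupied (X w) r).
    by left; have [m Hm] := vor_continuous wr oO Ow; exists r => //; exists m.
  right; split=> [r _ wr|]; first by apply: wN; exists r.
  rewrite (_ : (fun=> 0%N) = X w)//; apply/funext => x.
  by apply/esym; exact: Xw0.
move=> [[r _ [m _ [wr H]]]|[wN]]; first exact: H.
rewrite (_ : (fun=> 0%N) = X w)//; apply/funext => x.
by apply/esym; apply: Xw0 => -[r]; exact: wN.
Qed.

Lemma measurable_vor :
  measurable_fun setT (fun w => vor (X w) : borel_vague R G).
Proof.
apply: (@measurability _ _ Om (borel_vague R G) setT _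
  (@open (vague R G))) => // _ [W oW <-].
by rewrite setTI; exact: measurable_vor_open.
Qed.

End measurability.

Section comparison_principle.
Variables (R : realType) (G : rooted_graph).
Variables (dX : measure_display) (OmX : measurableType dX) (PX : probability OmX R).
Variables (dY : measure_display) (OmY : measurableType dY) (PY : probability OmY R).
Variables (X : OmX -> vertices G -> nat) (Y : OmY -> vertices G -> nat).
Hypothesis mX : forall x k, measurable [set w | X w x = k].
Hypothesis mY : forall x k, measurable [set w | Y w x = k].
Variables (L : nat -> nat) (r n : nat) (delta : R).
Local Open Scope ereal_scope.

Hypothesis XY : forall g : (vertices G -> nat) -> R,
  depends_on (ball_seq G (r + n.*2)) g -> (forall z, 0 <= g z <= 1)%R ->
  \int[PX]_w (g (X w))%:E <= \int[PY]_w (g (Y w))%:E + delta%:E.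

(** These are the conditions that [vor_uniform] puts on [Z]. They only involve the ball of radius
    [r + n.*2], so their probability can itself be compared between the two processes. *)
Definition tame (Z : vertices G -> nat) := occupied Z r /\
  forall k, (k <= n)%N -> (size (points Z (r + k.*2)) <= L k)%N.

Lemma depends_on_tame : depends_on (ball_seq G (r + n.*2)) tame.
Proof.
move=> z z' zz'; rewrite /tame; congr (_ /\ _).
  exact: (depends_on_leq (leq_addr _ _) (@depends_on_occupied G r) zz').
apply: eq_forall => k; apply/propext.
have E : (k <= n)%N -> points z' (r + k.*2) = points z (r + k.*2).
  move=> kn; apply: points_same => x xk; apply/esym/zz'.
  by rewrite mem_ball_seq (leq_trans xk)// leq_add2l leq_double.
by split => H kn; [rewrite E|rewrite -E] => //; exact: H.
Qed.

Lemma measurable_tame : measurable [set w | tame (X w)].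
Proof. exact: (measurable_depends_on mX depends_on_tame). Qed.

(** Two functions are allowed so that the pair can be the indicators of a set and of its
    neighborhood, or twice the same continuous function. *)
Lemma comparison_principle (phi psi : vague R G -> R) (eps : R) :
    (forall c, 0 <= phi c <= 1)%R -> (forall c, 0 <= psi c <= 1)%R -> (0 <= eps)%R ->
    measurable_fun setT (fun w => (phi (vor (X w)))%:E) ->
    measurable_fun setT (fun w => (psi (vor (Y w)))%:E) ->
    (forall Z Z', tame Z -> same_on (r + n.*2) Z Z' ->
       phi (vor Z') <= psi (vor Z) + eps)%R ->
  \int[PX]_w (phi (vor (X w)))%:E <=
  \int[PY]_w (psi (vor (Y w)))%:E + (eps + delta)%:E + PX (~` [set w | tame (X w)]).
Proof.
move=> phi01 psi01 eps0 mphi mpsi phipsi.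
(* [phi (vor Z)] depends on all points. Its supremum over the configurations that agree with [Z] on
   the ball is local, lies above [phi (vor Z)] and, for tame [Z], below [psi (vor Z) + eps]. *)
pose S (Z : vertices G -> nat) :=
  [set phi (vor Z') | Z' in [set Z' | same_on (r + n.*2) Z Z']].
pose g Z := if `[< tame Z >] then sup (S Z) else 0%R.
have SZ Z : S Z (phi (vor Z)) by exists Z.
have S1 Z : ubound (S Z) 1%R by move=> _ [Z' _ <-]; case/andP: (phi01 (vor Z')).
have hS Z : has_sup (S Z) by split; [exists (phi (vor Z))|exists 1%R].
have phi_sup Z : (phi (vor Z) <= sup (S Z))%R by apply: ub_le_sup => //; exists 1%R.
have g01 Z : (0 <= g Z <= 1)%R.
  rewrite /g; case: asboolP => // _; last by rewrite lexx ler01.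
  apply/andP; split; last by apply: ge_sup => //; exists (phi (vor Z)).
  by apply: le_trans (phi_sup Z); case/andP: (phi01 (vor Z)).
have g0 Z : (0 <= g Z)%R by case/andP: (g01 Z).
have gD : depends_on (ball_seq G (r + n.*2)) g.
  move=> z z' zz'; rewrite /g (depends_on_tame zz') (_ : S z = S z')//.
  apply/seteqP; split => _ [Z' zZ' <-]; exists Z' => // x xN; rewrite zZ'//.
    by rewrite zz'// mem_ball_seq.
  by rewrite -zz'// mem_ball_seq.
have mgX := measurable_fun_depends_on mX gD.
have mgY := measurable_fun_depends_on mY gD.
have mT := measurable_tame.
have psi0 c : (0 <= psi c)%R by case/andP: (psi01 c).
have mI : measurable_fun setT
    (fun w => (\1_(~` [set w | tame (X w)]) w : R)%:E).
  by apply/measurable_EFinP; apply: measurable_indic; exact: measurableC.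
apply: (@le_trans _ _ (\int[PX]_w ((g (X w))%:E + (\1_(~` [set w | tame (X w)]) w)%:E))).
  apply: ge0_le_integral => //.
  - by move=> w _; rewrite lee_fin; case/andP: (phi01 (vor (X w))).
  - exact: emeasurable_funD.
  - move=> w _; rewrite -EFinD lee_fin /g indicE.
    case: asboolP => Tw; first by rewrite memNset//= addr0.
    by rewrite mem_set// add0r; case/andP: (phi01 (vor (X w))).
rewrite ge0_integralD//; last by move=> w _; rewrite lee_fin.
rewrite integral_indic//; last exact: measurableC.
rewrite setIT leeD2r//; apply: le_trans (XY gD g01) _.
rewrite EFinD addeA leeD2r//.
apply: (@le_trans _ _ (\int[PY]_w ((psi (vor (Y w)))%:E + eps%:E))).
  apply: ge0_le_integral => //.
  - by move=> w _; rewrite lee_fin.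
  - exact: emeasurable_funD.
  - move=> w _; rewrite -EFinD lee_fin /g.
    case: asboolP => Tw; last by rewrite addr_ge0.
    by apply: ge_sup => [|_ [Z' YZ' <-]]; [exists (phi (vor (Y w)))|exact: phipsi YZ'].
rewrite ge0_integralD//; last by move=> w _; rewrite lee_fin.
by rewrite leeD2l// integral_cst//= probability_setT mule1.
Qed.

End comparison_principle.

(** * Poisson tails and growth of balls *)

(** Uniformity in the parameter comes from domination: for 0 <= a <= C the weights of parameter a
    are at most exp(C) times those of parameter C. *)
Lemma poisson_tail (R : realType) (C eta : R) : 0 <= C -> 0 < eta ->
  exists N : nat, forall a, 0 <= a <= C ->
    (poisson_prob a 0 [set j | (N < j)%N] <= eta%:E)%E.
Proof.
move=> C0 eta0.
have tail : (\sum_(N <= k <oo) (poisson_weight C k)%:E @[N --> \oo] --> 0)%E.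
  apply: nneseries_tail_cvg => [|k _]; first by rewrite nneseries_poisson_weight// ltry.
  by rewrite lee_fin poisson_weight_ge0.
have eC : 0 < eta / expR C by rewrite divr_gt0// expR_gt0.
have /fine_cvgP[[N1 _ fN] /cvgrPdist_lt/(_ _ eC)[N2 _ N2P]] := tail.
exists (maxn N1 N2) => a /andP[a0 aC]; set N := maxn N1 N2.
have aeC k : poisson_weight a k <= expR C * poisson_weight C k.
  rewrite /poisson_weight [leRHS]mulrA -expRD subrr expR0 mul1r.
  rewrite -[leRHS]mul1r ler_pM ?expR_ge0 ?divr_ge0 ?exprn_ge0//.
    by rewrite -[leRHS]expR0 ler_expR oppr_le0.
  by rewrite ler_wpM2r ?invr_ge0// lerXn2r// nnegrE (le_trans a0).
have a_ge0 k : (0 <= (poisson_weight a k)%:E)%E by rewrite lee_fin poisson_weight_ge0.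
have C_ge0 k : (0 <= (poisson_weight C k)%:E)%E by rewrite lee_fin poisson_weight_ge0.
have -> : poisson_prob a 0 [set j | (N < j)%N] =
    (\sum_(N.+1 <= k <oo) (poisson_weight a k)%:E)%E.
  rewrite -nneseries_addn// (_ : [set j | _] = \bigcup_i [set (i + N.+1)%N]); last first.
    apply/seteqP; split => j /=; first by move=> Nj; exists (j - N.+1)%N; rewrite //= subnK.
    by move=> [i _ ->]; rewrite leq_addl.
  rewrite measure_semi_bigcup//.
    by apply: eq_eseriesr => k _; rewrite -poisson_prob_set1.
  apply/trivIsetP => i j _ _ ij; apply/seteqP; split => // k [/= -> /addIn ji].
  by rewrite ji eqxx in ij.
apply: (@le_trans _ _ (\sum_(N.+1 <= k <oo) (expR C)%:E * (poisson_weight C k)%:E)%E).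
  by apply: lee_nneseries => // k _; rewrite -EFinM lee_fin.
have N1N : (N1 <= N.+1)%N by rewrite ltnW// ltnS leq_maxl.
have N2N : (N2 <= N.+1)%N by rewrite ltnW// ltnS leq_maxr.
rewrite nneseriesZl// -(fineK (fN _ N1N)) -EFinM lee_fin.
have := N2P _ N2N; rewrite /= sub0r normrN => /ltW; rewrite ler_norml => /andP[_].
by rewrite ler_pdivlMr ?expR_gt0// mulrC.
Qed.

Section growth.
Variables (R : realType) (G : rooted_graph).
Variable mu : {measure set (vertices G) -> \bar R}.
Hypothesis mu_fin : forall x : vertices G, (mu [set x] < +oo)%E.
Hypothesis mu_inf : mu [set: vertices G] = +oo%E.

Lemma mu_finite_set (A : set (vertices G)) : finite_set A -> (mu A < +oo)%E.
Proof.
move=> /finite_seqP[s ->]; elim: s => [|x s IH]; first by rewrite set_nil measure0 ltry.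
rewrite (_ : [set` x :: s] = [set x] `|` [set` s]); last first.
  apply/seteqP; split => y /=; rewrite inE; first by move=> /predU1P[|]; [left|right].
  by move=> [->|->]; rewrite ?eqxx ?orbT.
apply: le_lt_trans (measureU2 _ _ _) _ => //.
by apply: lte_add_pinfty => //; exact: mu_fin.
Qed.

Lemma gball_nball m : @gball R G m%:R = @nball G m.
Proof. by apply/seteqP; split => x; rewrite /gball /nball /= ler_nat. Qed.

Definition nvol m : R := fine (mu (@nball G m)).

Lemma nvolE m : (nvol m)%:E = mu (@nball G m).
Proof.
rewrite fineK// ge0_fin_numE//; apply: mu_finite_set; exact: finite_nball.
Qed.

Lemma nvol_ge0 m : 0 <= nvol m. Proof. exact: fine_ge0. Qed.

Lemma volumeE r : (volume mu r)%:E = mu (gball r).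
Proof.
rewrite fineK// ge0_fin_numE//; apply: mu_finite_set.
apply: (@sub_finite_set _ _ (@nball G (Num.truncn r).+1)); last exact: finite_nball.
move=> x; rewrite /gball /nball /= => xr; apply: ltnW.
by rewrite -(ltr_nat R) (le_lt_trans xr)// truncnS_gt.
Qed.

Lemma volume_le r r' : r <= r' -> volume mu r <= volume mu r'.
Proof.
move=> rr; rewrite -lee_fin !volumeE le_measure ?inE// => x.
by rewrite /gball/= => /le_trans; apply.
Qed.

Lemma nvol_volume m : nvol m = volume mu m%:R.
Proof. by rewrite /volume gball_nball. Qed.

Lemma nvol_leq m n : (m <= n)%N -> nvol m <= nvol n.
Proof. by move=> mn; rewrite !nvol_volume volume_le// ler_nat. Qed.

Lemma nvol_unbounded (A : R) : exists m, A < nvol m.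
Proof.
have : mu \o (@nball G) @ \oo --> mu (\bigcup_m @nball G m).
  apply: nondecreasing_cvg_mu => //.
  by move=> m n mn; apply/subsetPset; exact: nball_subset.
rewrite (_ : \bigcup_m _ = setT); last first.
  by apply/seteqP; split => // x _; exists (gdist (Defs.root G) x) => //; exact: nball_self.
rewrite mu_inf => /cvgeyPgt/(_ A)[m _ /(_ m (leqnn m)) /= Am].
by exists m; rewrite -lte_fin nvolE.
Qed.

Variable r0 : R.
Hypothesis r0_gt0 : 0 < r0.
Hypothesis limsup_F : (limf_esup
  (fun r : R => (volume mu (r + r0) / volume mu r)%:E) (pinfty_nbhs R) < +oo)%E.

Lemma volume_doubling : exists C M : R, 0 <= C /\
  forall r, M < r -> volume mu (r + r0) <= C * volume mu r.
Proof.
have [y [V [M [_ MV]] <-] Vy] := ereal_inf_lt limsup_F.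
have [C [C0 VC]] : exists C, 0 <= C /\ (ereal_sup [set
    (volume mu (r + r0) / volume mu r)%:E | r in V] <= C%:E)%E.
  case: ereal_sup Vy => [c _|//|_].
    by exists (Num.max 0 c); rewrite le_max lexx lee_fin le_max lexx orbT.
  by exists 0; split => //; exact: leNye.
have [m m0] := nvol_unbounded 0.
(* Where the volume vanishes, the quotient is 0 by convention and bounds nothing; past [m] the
   denominator is positive and can be cleared. *)
have pos r : Num.max M m%:R < r -> 0 < volume mu r.
  rewrite gt_max => /andP[_ /ltW mr]; apply: lt_le_trans m0 _.
  by rewrite nvol_volume volume_le.
exists C, (Num.max M m%:R); split => // r Mr.
rewrite -ler_pdivrMr ?pos// -lee_fin; apply: le_trans VC.
apply: ereal_sup_ubound; exists r => //; apply: MV.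
by move: Mr; rewrite gt_max => /andP[].
Qed.

Lemma nvol_doubling : exists (C : nat -> R) (m0 : nat), forall k m, (m0 <= m)%N ->
  0 <= C k /\ nvol (m + k) <= C k * nvol m.
Proof.
have [C [M [C0 CM]]] := volume_doubling.
(* The exponent counts enough steps of length [r0] to cover the distance [k]; the starting radius
   exceeds [M], so every step is in the doubling range. *)
exists (fun k => C ^+ (Num.truncn (k%:R / r0)).+1), (Num.truncn (Num.max M 0)).+1 => k m Mm.
split; first by rewrite exprn_ge0.
have {}Mm : M < m%:R.
  have := @truncnS_gt R (Num.max M 0); rewrite gt_max => /andP[+ _] => /lt_le_trans; apply.
  by rewrite ler_nat.
have H j : volume mu (m%:R + j%:R * r0) <= C ^+ j * volume mu m%:R.
  elim: j => [|j IH]; first by rewrite mul0r addr0 expr0 mul1r.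
  rewrite -natr1 mulrDl mul1r addrA exprS -mulrA.
  apply: le_trans (ler_wpM2l C0 IH); apply: CM.
  by rewrite (lt_le_trans Mm)// lerDl mulr_ge0// ltW.
rewrite !nvol_volume; apply: le_trans (H _); apply: volume_le.
rewrite natrD lerD2l -ler_pdivrMr//; exact/ltW/truncnS_gt.
Qed.

Hypothesis mu2_small :
  fine (mu2 mu (gball (n%:R : R))) / fine (mu (gball (n%:R : R))) ^+ 2
    @[n --> \oo] --> (0 : R).

Lemma mu2E m : fine (mu2 mu (@nball G m)) =
  \sum_(x <- ball_seq G m) fine (mu [set x]) ^+ 2.
Proof.
rewrite /mu2 esum_fset; last 2 first.
- exact: finite_nball.
- by move=> x _; rewrite sqre_ge0.
rewrite (fsbig_fwiden (ball_seq G m)); last 3 first.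
- by move=> x xm /=; rewrite mem_ball_seq.
- exact: ball_seq_uniq.
- by move=> x [/= + /negP]; rewrite mem_ball_seq => ->.
rewrite -[RHS]/(fine (_%:E)) -sumEFin; congr fine; apply: eq_bigr => x _.
by rewrite EFin_expe fineK// ge0_fin_numE.
Qed.

(** Take the least r with l F(r) >= M. Then l F(r - 1) < M, and doubling from r - 1 bounds l F(r +
    2k); the shift 2k + 1 explains [k.*2.+1]. The bounds [C] precede [n] because [n] will be chosen
    in terms of them. *)
Lemma growth (M : R) : 0 < M -> exists C : nat -> R, forall n (delta : R), 0 < delta ->
  \forall l \near 0^'+, exists r : nat, [/\ M <= l * nvol r,
    forall k, (k <= n)%N -> l * nvol (r + k.*2) <= C k &
    \sum_(x <- ball_seq G (r + n.*2)) (l * fine (mu [set x])) ^+ 2 <= delta].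
Proof.
move=> M0; have [C [m0 Cm0]] := nvol_doubling.
exists (fun k => C k.*2.+1 * M) => n delta delta0.
(* [D] bounds l F(r + 2n), so the sum of squares is at most [D ^+ 2] times the ratio in [mu2_small];
   adding 1 keeps the divisor positive. *)
pose D := C n.*2.+1 * M.
have D0 : 0 < D ^+ 2 + 1 by rewrite ltr_wpDl// sqr_ge0.
have eps0 : 0 < delta / (D ^+ 2 + 1) by rewrite divr_gt0.
have /cvgrPdist_lt/(_ _ eps0)[N _ HN] := mu2_small.
pose m1 := (m0 + N)%N.
have v0 : 0 < nvol m1 + 1 by rewrite ltr_wpDl// nvol_ge0.
near=> l.
have l0 : 0 < l by near: l; exact: nbhs_right_gt.
have lM : l < M / (nvol m1 + 1) by near: l; apply: nbhs_right_lt; rewrite divr_gt0.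
have ex_r : exists m, M / l <= nvol m.
  by have [m /ltW Hm] := nvol_unbounded (M / l); exists m.
case: (ex_minnP ex_r) => r Mr rmin; exists r.
(* For small [l] the ball of radius [m1] is too light to reach [M / l], so [r - 1] is in the
   doubling range and the bound on the ratio applies from [r] on. *)
have rm1 : (m1 < r)%N.
  rewrite ltnNge; apply/negP => /nvol_leq rm; have := le_trans Mr rm.
  rewrite leNgt => /negP; apply; rewrite ltr_pdivlMr//.
  move: lM; rewrite ltr_pdivlMr// => /(lt_trans _); apply.
  by rewrite mulrC ltr_pM2l// ltrDl.
case: r Mr rmin rm1 => // r Mr rmin rm1.
have rM : nvol r < M / l by rewrite ltNge; apply/negP => /rmin; rewrite ltnn.
have bd k : l * nvol (r.+1 + k.*2) <= C k.*2.+1 * M.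
  have [|C0 HC] := Cm0 k.*2.+1 r; first by rewrite (leq_trans (leq_addr N _)).
  rewrite addSnnS; apply: le_trans (ler_wpM2l (ltW l0) HC) _.
  rewrite mulrCA ler_wpM2l// mulrC -ler_pdivlMr//; exact: ltW.
split => [|//|]; first by rewrite mulrC -ler_pdivrMr.
have Nr : (N <= r.+1 + n.*2)%N.
  by apply: leq_trans (leq_addr _ _); rewrite (leq_trans _ (ltnW rm1))// leq_addl.
have := HN _ Nr; rewrite /= sub0r normrN => /ltW.
rewrite gball_nball ler_norml => /andP[_].
have vpos : 0 < nvol (r.+1 + n.*2).
  apply: lt_le_trans (nvol_leq (leq_addr _ _)); apply: lt_le_trans Mr.
  by rewrite divr_gt0.
rewrite ler_pdivrMr ?exprn_gt0// -/(nvol _) mu2E => H.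
under eq_bigr do rewrite exprMn.
rewrite -mulr_sumr; apply: le_trans (ler_wpM2l (sqr_ge0 l) H) _.
rewrite mulrCA -exprMn -[leRHS](divfK (lt0r_neq0 D0)) ler_wpM2l//.
  by rewrite ltW.
apply: (@le_trans _ _ (D ^+ 2)); last by rewrite lerDl.
have lv_ge0 : 0 <= l * nvol (r.+1 + n.*2) by rewrite mulr_ge0// ltW.
have D_ge0 : 0 <= D := le_trans lv_ge0 (bd n).
by rewrite lerXn2r ?nnegrE//; exact: bd.
Unshelve. all: by end_near.
Qed.

End growth.

Lemma sum_dyadic (R : realType) (e : R) n : 0 <= e -> \sum_(k < n) e / 2 ^+ k.+1 <= e.
Proof.
move=> e0; suff -> : \sum_(k < n) e / 2 ^+ k.+1 = e - e / 2 ^+ n.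
  by rewrite gerBl divr_ge0// exprn_ge0.
elim: n => [|n IH]; first by rewrite big_ord0 expr0 divr1 subrr.
rewrite big_ord_recr/= IH exprS invfM mulrA.
rewrite -[X in - X](_ : 2 * (e / 2 / 2 ^+ n) = _) 1?[X in - X]mulrAC.
  by rewrite mulrCA !mulrA; lra.
by rewrite !mulrA [2 * e]mulrC mulfK.
Qed.

Section tameness.
Variables (R : realType) (G : rooted_graph).
Variable mu : {measure set (vertices G) -> \bar R}.
Hypothesis mu_fin : forall x : vertices G, (mu [set x] < +oo)%E.

(** Tameness fails if [nball r] is empty, of probability at most exp(-M), or if one of the n + 1
    Poisson counts is too large; a union bound adds these up. *)
Lemma not_tame_le d (Om : measurableType d) (P : probability Om R) (l : R)
    (X : Om -> vertices G -> nat) (L : nat -> nat) (C eta : nat -> R) (M : R) r n :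
    0 < l -> poisson_process P (fun A => (l%:E * mu A)%E) X ->
    M <= l * nvol mu r -> (forall k, (k <= n)%N -> l * nvol mu (r + k.*2) <= C k) ->
    (forall k a, 0 <= a <= C k ->
      (poisson_prob a 0 [set j | (L k < j)%N] <= (eta k)%:E)%E) ->
  (P (~` [set w | tame L r n (X w)]) <= (expR (- M) + \sum_(k < n.+1) eta k)%:E)%E.
Proof.
move=> l0 XP Ml lC Leta; have mX := poisson_process_measurable XP.
have [_ XA _] := XP.
have lmuE m : fine (l%:E * mu (@nball G m)) = l * nvol mu m by rewrite -nvolE.
have pts m B : P [set w | B (size (points (X w) m))] = poisson_prob (l * nvol mu m) 0 B.
  rewrite -lmuE -XA; last exact: finite_nball.
  by congr (P _); apply/seteqP; split => w /=; rewrite size_points.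
have mpts m (B : set nat) : measurable [set w | B (size (points (X w) m))].
  apply: (measurable_depends_on mX (s := ball_seq G m)
    (A := [set Z | B (size (points Z m))])) => z z' zz' /=.
  by rewrite (@points_same _ z z')// => x xm; rewrite zz'// mem_ball_seq.
have nv m : 0 <= l * nvol mu m by rewrite mulr_ge0 ?nvol_ge0// ltW.
pose F k := [set w | [set j | (L k < j)%N] (size (points (X w) (r + k.*2)))].
have sub : ~` [set w | tame L r n (X w)] `<=`
    [set w | [set 0%N] (size (points (X w) r))] `|` \big[setU/set0]_(k < n.+1) F k.
  move=> w /= wT; rewrite -bigcup_mkord.
  have [w0|w0] := pselect (size (points (X w) r) = 0%N); [by left|right].
  apply: contrapT => wF; apply: wT; split; last first.
    move=> k kn; rewrite leqNgt; apply/negP => Lk; apply: wF; exists k => //=.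
  case E : (points (X w) r) => [|x s]; first by rewrite E in w0.
  have : x \in points (X w) r by rewrite E mem_head.
  move=> /flattenP[_ /mapP[y yr ->]]; rewrite mem_nseq => /andP[Xy _].
  by exists y => //; rewrite /nball/= -mem_ball_seq.
apply: le_trans (le_measure P _ _ sub) _.
- by rewrite inE; apply: measurableC; exact: measurable_tame.
- by rewrite inE; apply: measurableU => //; apply: bigsetU_measurable => k _; exact: mpts.
apply: le_trans (measureU2 _ _ _) _ => //.
  by apply: bigsetU_measurable => k _; exact: mpts.
rewrite EFinD; apply: leeD.
  rewrite -[leLHS]/(P [set w | [set 0%N] (size (points (X w) r))]) pts.
  rewrite poisson_prob_set1// /poisson_weight expr0 fact0 divr1 mulr1.
  by rewrite lee_fin ler_expR lerN2.
apply: (le_trans (@Boole_inequality _ _ _ P F n.+1 _)); first by move=> k _; exact: mpts.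
rewrite -sumEFin; apply: lee_sum => k _.
rewrite -[leLHS]/(P (F k)) pts.
by apply: Leta; rewrite nv lC// -ltnS.
Qed.

End tameness.

(** * Closeness of the two tessellations *)

Section closeness.
Variables (R : realType) (G : rooted_graph).
Variable mu : {measure set (vertices G) -> \bar R}.
Hypothesis mu_fin : forall x : vertices G, (mu [set x] < +oo)%E.
Hypothesis mu_inf : mu [set: vertices G] = +oo%E.
Variable r0 : R.
Hypothesis r0_gt0 : 0 < r0.
Hypothesis limsup_F : (limf_esup
  (fun r : R => (volume mu (r + r0) / volume mu r)%:E) (pinfty_nbhs R) < +oo)%E.
Hypothesis mu2_small :
  fine (mu2 mu (gball (n%:R : R))) / fine (mu (gball (n%:R : R))) ^+ 2
    @[n --> \oo] --> (0 : R).
Variables (dX : measure_display) (OmX : R -> measurableType dX).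
Variables (PX : forall l, probability (OmX l) R) (X : forall l, OmX l -> vertices G -> nat).
Hypothesis X_poisson : forall l : R, 0 < l ->
  poisson_process (PX l) (fun A => (l%:E * mu A)%E) (@X l).
Variables (dY : measure_display) (OmY : R -> measurableType dY).
Variables (PY : forall l, probability (OmY l) R) (Y : forall l, OmY l -> set (vertices G)).
Hypothesis Y_bernoulli : forall l : R, 0 < l ->
  bernoulli_process (PY l) (fun x => Num.min 1 (l * fine (mu [set x]))) (@Y l).

Let VX l (w : OmX l) : vague R G := vor (X w).
Let VY l (w : OmY l) : vague R G := vor (multiset_of (Y w)).

Lemma measurable_VX l : 0 < l ->
  measurable_fun setT (@VX l : OmX l -> borel_vague R G).
Proof.
by move=> /X_poisson/poisson_process_measurable; exact: measurable_vor.
Qed.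

Lemma measurable_VY l : 0 < l ->
  measurable_fun setT (@VY l : OmY l -> borel_vague R G).
Proof.
by move=> /Y_bernoulli/bernoulli_process_measurable; exact: measurable_vor.
Qed.

(** [V] stands for a neighborhood of the diagonal, such as the pairs at distance less than e. The
    range of [l] is chosen before [phi] and [psi], as the Prokhorov distance requires uniformity
    over all Borel sets. *)
Lemma vor_close (V : vague R G -> vague R G -> Prop) (e : R) : 0 < e ->
    (forall c : vague R G, exists O : set (vague R G),
       [/\ open O, O c & forall a b, O a -> O b -> V a b]) ->
  \forall l \near 0^'+, forall (phi psi : vague R G -> R) (eps : R),
    (forall c, 0 <= phi c <= 1) -> (forall c, 0 <= psi c <= 1) -> 0 <= eps ->
    measurable_fun setT (phi : borel_vague R G -> R) ->
    measurable_fun setT (psi : borel_vague R G -> R) ->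
    (forall a b, V a b -> phi b <= psi a + eps) ->
    (\int[PX l]_w (phi (VX w))%:E <= \int[PY l]_w (psi (VY w))%:E + (eps + e)%:E)%E /\
    (\int[PY l]_w (phi (VY w))%:E <= \int[PX l]_w (psi (VX w))%:E + (eps + e)%:E)%E.
Proof.
move=> e0 HV.
(* Error budget in units of [e4]: one for the comparison; for the Poisson process one for emptiness
   and one for the dyadic sum of tails; for the Bernoulli process one more, to transfer tameness. *)
pose e4 := e / 4; have e40 : 0 < e4 by rewrite divr_gt0.
(* With M = 1 / e4, exp(M) >= 1 + M gives exp(-M) <= e4. *)
have M0 : 0 < e4^-1 by rewrite invr_gt0.
have [C HC] := growth mu_fin mu_inf r0_gt0 limsup_F mu2_small M0.
have /choice[L HL] k : exists N : nat, forall a, 0 <= a <= Num.max 0 (C k) ->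
    (poisson_prob a 0 [set j | (N < j)%N] <= (e4 / 2 ^+ k.+1)%:E)%E.
  by apply: poisson_tail; rewrite ?le_max ?lexx// divr_gt0// exprn_gt0.
have [n Hn] := vor_uniform L HV.
near=> l; move=> phi psi eps phi01 psi01 eps0 mphi mpsi phipsi.
have l0 : 0 < l by near: l; exact: nbhs_right_gt.
have [r [Mr Cr dr]] : exists r : nat, [/\ e4^-1 <= l * nvol mu r,
    forall k, (k <= n)%N -> l * nvol mu (r + k.*2) <= C k &
    \sum_(x <- ball_seq G (r + n.*2)) (l * fine (mu [set x])) ^+ 2 <= e4].
  by near: l; exact: HC.
have XP := X_poisson l0; have YB := Y_bernoulli l0.
have mX := poisson_process_measurable XP; have mY := bernoulli_process_measurable YB.
have nuE x : fine (l%:E * mu [set x]) = l * fine (mu [set x]).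
  by rewrite fineM// ge0_fin_numE.
have nu0 x : (0 <= l%:E * mu [set x])%E by rewrite mule_ge0// lee_fin ltW.
have YB' : bernoulli_process (PY l)
    (fun x => Num.min 1 (fine (l%:E * mu [set x]))) (@Y l).
  by under eq_fun do rewrite nuE.
have dr' : ((\sum_(x <- ball_seq G (r + n.*2)) fine (l%:E * mu [set x]) ^+ 2)%:E
    <= e4%:E)%E.
  by rewrite lee_fin; under eq_bigr do rewrite nuE.
have XY (g : (vertices G -> nat) -> R) :
    depends_on (ball_seq G (r + n.*2)) g -> (forall z, 0 <= g z <= 1) ->
    (\int[PX l]_w (g (X w))%:E <= \int[PY l]_w (g (multiset_of (Y w)))%:E + e4%:E)%E.
  move=> gs g01; have := poisson_le_bernoulli nu0 XP YB' (ball_seq_uniq _ _) gs g01.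
  by move/le_trans; apply; rewrite leeD2l.
have YX (g : (vertices G -> nat) -> R) :
    depends_on (ball_seq G (r + n.*2)) g -> (forall z, 0 <= g z <= 1) ->
    (\int[PY l]_w (g (multiset_of (Y w)))%:E <= \int[PX l]_w (g (X w))%:E + e4%:E)%E.
  move=> gs g01; have := bernoulli_le_poisson nu0 XP YB' (ball_seq_uniq _ _) gs g01.
  by move/le_trans; apply; rewrite leeD2l.
pose tX := ~` [set w | tame L r n (@X l w)].
pose tY := ~` [set w | tame L r n (multiset_of (@Y l w))].
have tXe : (PX l tX <= (e4 + e4)%:E)%E.
  have lC k : (k <= n)%N -> l * nvol mu (r + k.*2) <= Num.max 0 (C k).
    by move=> /Cr H; rewrite le_max H orbT.
  apply: le_trans (not_tame_le mu_fin l0 XP Mr lC HL) _.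
  rewrite lee_fin; apply: lerD; last by apply: sum_dyadic; exact: ltW.
  have := expR_ge1Dx e4^-1; rewrite expRN => H.
  rewrite -[leRHS]invrK lef_pV2 ?posrE ?expR_gt0 ?invr_gt0//.
  by apply: le_trans H; rewrite lerDr.
(* Failure of tameness has a local indicator, so its Bernoulli probability exceeds the Poisson one
   by at most [e4]. *)
have tYe : (PY l tY <= (e4 + e4 + e4)%:E)%E.
  have mtX : measurable tX by apply: measurableC; exact: measurable_tame.
  have mtY : measurable tY by apply: measurableC; exact: measurable_tame.
  have gs : depends_on (ball_seq G (r + n.*2))
      (fun Z => if `[< tame L r n Z >] then 0 else 1 : R).
    by move=> z z' zz'; rewrite (depends_on_tame L zz').
  have /YX := gs => /(_ _)/le_trans YXl.
  have E1 : (\int[PY l]_w (if `[< tame L r n (multiset_of (Y w)) >]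
      then 0 else 1 : R)%:E)%E = PY l tY.
    transitivity (\int[PY l]_w (\1_tY w)%:E)%E; last by rewrite integral_indic// setIT.
    apply: eq_integral => w _.
    rewrite indicE /tY; case: asboolP => tw; first by rewrite memNset//=; apply.
    by rewrite mem_set.
  have E2 : (\int[PX l]_w (if `[< tame L r n (X w) >] then 0 else 1 : R)%:E)%E = PX l tX.
    transitivity (\int[PX l]_w (\1_tX w)%:E)%E; last by rewrite integral_indic// setIT.
    apply: eq_integral => w _.
    rewrite indicE /tX; case: asboolP => tw; first by rewrite memNset//=; apply.
    by rewrite mem_set.
  rewrite -E1; apply: YXl; first by move=> z; case: asbool; rewrite ?lexx ?ler01.
  by rewrite E2 EFinD leeD2r.
have VV Z Z' : tame L r n Z -> same_on (r + n.*2) Z Z' ->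
    phi (vor Z') <= psi (vor Z) + eps.
  by move=> [Zr ZL] ZZ'; apply: phipsi; exact: (Hn _ _ _ Zr).
have mphiX : measurable_fun setT (fun w : OmX l => (phi (VX w))%:E).
  apply/measurable_EFinP; exact: (measurableT_comp mphi (measurable_VX l0)).
have mpsiX : measurable_fun setT (fun w : OmX l => (psi (VX w))%:E).
  apply/measurable_EFinP; exact: (measurableT_comp mpsi (measurable_VX l0)).
have mphiY : measurable_fun setT (fun w : OmY l => (phi (VY w))%:E).
  apply/measurable_EFinP; exact: (measurableT_comp mphi (measurable_VY l0)).
have mpsiY : measurable_fun setT (fun w : OmY l => (psi (VY w))%:E).
  apply/measurable_EFinP; exact: (measurableT_comp mpsi (measurable_VY l0)).
split.
  have := comparison_principle mX mY XY phi01 psi01 eps0 mphiX mpsiY VV.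
  move/le_trans; apply; rewrite -addeA leeD2l//.
  apply: le_trans (leeD2l _ tXe) _; rewrite -EFinD lee_fin.
  by rewrite /e4; lra.
have := comparison_principle mY mX YX phi01 psi01 eps0 mphiY mpsiX VV.
move/le_trans; apply; rewrite -addeA leeD2l//.
apply: le_trans (leeD2l _ tYe) _; rewrite -EFinD lee_fin.
by rewrite /e4; lra.
Unshelve. all: by end_near.
Qed.

Lemma vor_prokhorov (rho : vague R G -> vague R G -> R) :
  is_metric rho -> metrizes rho ->
  prokhorov rho (law (PX l) (@VX l)) (law (PY l) (@VY l)) @[l --> 0^'+] --> 0.
Proof.
move=> rhom rhoV; have [rho_xx _ rho_sym rho_tri] := rhom.
(* Open neighborhoods are Borel even when [A] is an arbitrary set, so their indicators can serve as
   [psi]. *)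
have open_nbhd (A : set (vague R G)) (e : R) : open (neighborhood rho A e).
  apply/rhoV => y [x Ax xy]; exists (e - rho x y); rewrite ?subr_gt0// => z /= yz.
  by exists x => //; apply: le_lt_trans (rho_tri _ y _) _; lra.
apply/cvgrPdist_le => e e0.
have HV (c : vague R G) : exists O : set (vague R G),
    [/\ open O, O c & forall a b, O a -> O b -> rho a b < e].
  exists (neighborhood rho [set c] (e / 2)); split => //.
    by exists c => //; rewrite rho_xx divr_gt0.
  move=> a b [_ -> ca] [_ -> cb]; apply: le_lt_trans (rho_tri _ c _) _.
  by rewrite rho_sym [ltRHS](splitr e) ltrD.
apply: filterS2 (nbhs_right_gt 0) (vor_close e0 HV) => l l0 Hl.
(* The infimum of the empty set is 0 by convention, so nonnegativity holds in every case. *)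
have ge0 (B : set R) : (forall x, B x -> 0 < x) -> 0 <= inf B.
  move=> B0; have [Bn|/set0P/negP/negPn/eqP ->] := pselect (B !=set0).
    by apply: lb_le_inf => // x /B0/ltW.
  by rewrite inf0.
rewrite sub0r normrN ger0_norm /prokhorov; last by apply: ge0 => x [].
apply: ge_inf; first by exists 0 => x [/ltW].
split=> // A mA.
have mN : measurable (neighborhood rho A e : set (borel_vague R G)).
  by apply: sub_sigma_algebra; exact: open_nbhd.
have ind01 (B : set (vague R G)) c : 0 <= (\1_B c : R) <= 1.
  by rewrite indicE; case: (_ \in _); rewrite ?lexx ?ler01.
have intX (B : set (borel_vague R G)) : measurable B ->
    (\int[PX l]_w (\1_B (VX w))%:E = law (PX l) (@VX l) B)%E.
  move=> mB; rewrite /law /pushforward -[in RHS](setIT (_ @^-1` _)).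
  have mVB : measurable (@VX l @^-1` B).
    by rewrite -[X in measurable X]setTI; exact: measurable_VX.
  transitivity (\int[PX l]_w (\1_(@VX l @^-1` B) w)%:E)%E => //.
  by rewrite integral_indic.
have intY (B : set (borel_vague R G)) : measurable B ->
    (\int[PY l]_w (\1_B (VY w))%:E = law (PY l) (@VY l) B)%E.
  move=> mB; rewrite /law /pushforward -[in RHS](setIT (_ @^-1` _)).
  have mVB : measurable (@VY l @^-1` B).
    by rewrite -[X in measurable X]setTI; exact: measurable_VY.
  transitivity (\int[PY l]_w (\1_(@VY l @^-1` B) w)%:E)%E => //.
  by rewrite integral_indic.
have [] := Hl \1_A \1_(neighborhood rho A e) 0 (ind01 A) (ind01 _) (lexx 0).
- exact: measurable_indic.
- exact: measurable_indic.
- move=> a b ab; rewrite addr0 !indicE.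
  have [Ab|] := boolP (b \in A); last by [].
  by rewrite mem_set//; exists b; rewrite 1?rho_sym//; exact: set_mem.
by rewrite add0r !intX// !intY.
Qed.

Lemma measurable_continuous_vague (f : vague R G -> R) : continuous f ->
  measurable_fun setT (f : borel_vague R G -> R).
Proof.
move=> /continuousP cf.
apply: (measurability (@RGenOpens.G R)) => [|_ [_ [x [y ->]] <-]].
  exact: RGenOpens.measurableE.
by rewrite setTI; apply: sub_sigma_algebra; apply: cf; exact: interval_open.
Qed.

Lemma vor_integral_close (f : vague R G -> R) (M e : R) : 0 < e -> continuous f ->
    (forall c, `|f c| <= M) ->
  \forall l \near 0^'+,
    (\int[PX l]_w (f (VX w))%:E <= \int[PY l]_w (f (VY w))%:E + e%:E)%E /\
    (\int[PY l]_w (f (VY w))%:E <= \int[PX l]_w (f (VX w))%:E + e%:E)%E.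
Proof.
move=> e0 cf fM.
have M0 : 0 <= M := le_trans (normr_ge0 _) (fM point).
(* [f] is rescaled affinely into [0,1]; adding 1 keeps [K] positive when M = 0. Below, [e2] is
   chosen so that the error [e2 + e2] becomes [e] after multiplication by [K]. *)
pose K := 2 * M + 1; have K0 : 0 < K by rewrite ltr_wpDl// mulr_ge0.
pose f1 c := (f c + M) / K.
have f1K c : K * f1 c = f c + M by rewrite mulrC divfK// lt0r_neq0.
have f101 c : 0 <= f1 c <= 1.
  have := fM c; rewrite ler_norml => /andP[fM1 fM2].
  rewrite divr_ge0 ?(ltW K0)//= ?ler_pdivrMr// ?mul1r /K; lra.
have cf1 : continuous f1.
  by move=> c; exact: (cvgM (cvgD (cf c) (cvg_cst M)) (cvg_cst K^-1)).
pose e2 := e / (2 * K); have e20 : 0 < e2 by rewrite divr_gt0// mulr_gt0.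
have HV (c : vague R G) : exists O : set (vague R G),
    [/\ open O, O c & forall a b, O a -> O b -> `|f1 a - f1 b| < e2].
  exists (f1 @^-1` (ball (f1 c) (e2 / 2))); split.
  - by apply: open_comp => [? _|]; [exact: cf1|exact: ball_open].
  - by apply: ballxx; rewrite divr_gt0.
  - move=> a b; rewrite /ball /= => ca cb.
    rewrite -(subrKA (f1 c)) [ltRHS](splitr e2).
    by apply: le_lt_trans (ler_normD _ _) _; rewrite ltrD// distrC.
apply: filterS2 (nbhs_right_gt 0) (vor_close e20 HV) => l l0 Hl.
have [] := Hl f1 f1 e2 f101 f101 (ltW e20).
- exact: measurable_continuous_vague.
- exact: measurable_continuous_vague.
- by move=> a b ab; have := ler_norm (f1 b - f1 a); rewrite distrC; lra.
have E d (Om : measurableType d) (P : probability Om R) (W : Om -> vague R G) :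
    measurable_fun setT (W : Om -> borel_vague R G) ->
    (K%:E * \int[P]_w (f1 (W w))%:E = \int[P]_w (f (W w))%:E + M%:E)%E.
  move=> mW.
  have mfW : measurable_fun setT (f \o W).
    by apply: measurableT_comp mW; exact: measurable_continuous_vague.
  have mf1W : measurable_fun setT (f1 \o W).
    by apply: measurableT_comp mW; exact: measurable_continuous_vague.
  have fi : P.-integrable setT (EFin \o (f \o W)).
    apply: measurable_bounded_integrable => //.
      by apply: le_lt_trans (probability_le1 P measurableT) _; exact: ltry.
    exists M; split; first exact: num_real.
    by move=> x Mx w _ /=; exact: le_trans (fM _) (ltW Mx).
  rewrite -ge0_integralZl//; last 3 first.
  - exact/measurable_EFinP.
  - by move=> w _; rewrite lee_fin; case/andP: (f101 (W w)).
  - by rewrite lee_fin ltW.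
  under eq_integral do rewrite -EFinM f1K EFinD.
  rewrite integralD//; last exact: finite_measure_integrable_cst.
  by rewrite integral_cst//= probability_setT mule1.
have Ke : K * (e2 + e2) = e.
  by rewrite /e2; field; rewrite lt0r_neq0.
have scale (a b a1 b1 : \bar R) : (0 <= b1 -> K%:E * a1 = a + M%:E ->
    K%:E * b1 = b + M%:E -> a1 <= b1 + (e2 + e2)%:E -> a <= b + e%:E)%E.
  move=> b10 aE bE ab.
  have : (K%:E * a1 <= K%:E * (b1 + (e2 + e2)%:E))%E.
    by rewrite lee_wpmul2l// lee_fin ltW.
  rewrite ge0_muleDr//; last by rewrite lee_fin addr_ge0// ltW.
  by rewrite aE bE -EFinM Ke addeAC leeD2rE.
have f1W0 d (Om : measurableType d) (P : probability Om R) (W : Om -> vague R G) :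
    (0 <= \int[P]_w (f1 (W w))%:E)%E.
  by apply: integral_ge0 => w _; rewrite lee_fin; case/andP: (f101 (W w)).
have EX := E _ _ (PX l) (@VX l) (measurable_VX l0).
have EY := E _ _ (PY l) (@VY l) (measurable_VY l0).
move=> HX HY; split.
  by apply: scale EX EY HX; exact: f1W0.
by apply: scale EY EX HY; exact: f1W0.
Qed.

End closeness.

(** * Transfer of subsequential weak limits *)

Lemma cvg_of_close (R : realType) (a b : nat -> \bar R) (q : R) :
    (forall e : R, 0 < e -> \forall k \near \oo,
       (a k <= b k + e%:E)%E /\ (b k <= a k + e%:E)%E) ->
  a k @[k --> \oo] --> q%:E -> b k @[k --> \oo] --> q%:E.
Proof.
move=> ab /fine_cvgP[fa aq].
have fb : \forall k \near \oo, b k \is a fin_num.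
  near=> k; have fak : a k \is a fin_num by near: k.
  have [] : (a k <= b k + 1%:E)%E /\ (b k <= a k + 1%:E)%E by near: k; exact: ab.
  by move: fak; case: (a k) => // r _; case: (b k).
apply/fine_cvgP; split=> //; apply/cvgrPdist_le => e e0.
have e20 : 0 < e / 2 by rewrite divr_gt0.
near=> k.
have fak : a k \is a fin_num by near: k.
have fbk : b k \is a fin_num by near: k.
have qa : `|q - fine (a k)| <= e / 2.
  by near: k; have /cvgrPdist_le/(_ _ e20) := aq.
have [] : (a k <= b k + (e / 2)%:E)%E /\ (b k <= a k + (e / 2)%:E)%E.
  by near: k; exact: ab.
rewrite -(fineK fak) -(fineK fbk) -!EFinD !lee_fin /= => h1 h2.
by move: qa; rewrite !ler_norml => /andP[? ?]; apply/andP; split; lra.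
Unshelve. all: by end_near.
Qed.

Theorem lemma4p9 (R : realType) (G : rooted_graph)
  (mu : {measure set (vertices G) -> \bar R})
  (mu_fin : forall x : vertices G, (mu [set x] < +oo)%E)
  (mu_inf : mu [set: vertices G] = +oo%E)
  (r0 : R) (r0_gt0 : 0 < r0)
  (liminf_F : (1 < limf_einf
     (fun r : R => (volume mu (r + r0) / volume mu r)%:E) (pinfty_nbhs R))%E)
  (limsup_F : (limf_esup
     (fun r : R => (volume mu (r + r0) / volume mu r)%:E) (pinfty_nbhs R)
     < +oo)%E)
  (dX : measure_display) (OmX : R -> measurableType dX)
  (PX : forall l, probability (OmX l) R)
  (X : forall l, OmX l -> vertices G -> nat)
  (X_poisson : forall l : R, 0 < l ->
     poisson_process (PX l) (fun A => (l%:E * mu A)%E) (X l))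
  (dY : measure_display) (OmY : R -> measurableType dY)
  (PY : forall l, probability (OmY l) R)
  (Y : forall l, OmY l -> set (vertices G))
  (Y_bernoulli : forall l : R, 0 < l ->
     bernoulli_process (PY l) (fun x => Num.min 1 (l * fine (mu [set x])))
       (Y l))
  (mu2_small :
     fine (mu2 mu (gball (n%:R : R))) / fine (mu (gball (n%:R : R))) ^+ 2
       @[n --> \oo] --> (0 : R)) :
  (forall rho : vague R G -> vague R G -> R, is_metric rho -> metrizes rho ->
     prokhorov rho (law (PX l) (fun w => vor (X l w)))
                   (law (PY l) (fun w => vor (multiset_of (Y l w))))
       @[l --> 0^'+] --> (0 : R)) /\
  (forall Q : probability (borel_vague R G) R,
     subseq_weak_limit PX (fun l w => vor (X l w)) Q <->
     subseq_weak_limit PY (fun l w => vor (multiset_of (Y l w))) Q).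
Proof.
split.
  move=> rho; exact: (vor_prokhorov mu_fin mu_inf r0_gt0 limsup_F mu2_small
    X_poisson Y_bernoulli).
have close (u : nat -> R) (f : vague R G -> R) (e : R) : (forall k : nat, 0 < u k) ->
    u k @[k --> \oo] --> 0 -> 0 < e -> continuous f ->
    (exists M, forall c, `|f c| <= M) -> \forall k \near \oo,
    (\int[PX (u k)]_w (f (vor (X (u k) w)))%:E <=
      \int[PY (u k)]_w (f (vor (multiset_of (Y (u k) w))))%:E + e%:E)%E /\
    (\int[PY (u k)]_w (f (vor (multiset_of (Y (u k) w))))%:E <=
      \int[PX (u k)]_w (f (vor (X (u k) w)))%:E + e%:E)%E.
  move=> u0 uc e0 cf [M fM].
  have H := vor_integral_close mu_fin mu_inf r0_gt0 limsup_F mu2_small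
    X_poisson Y_bernoulli e0 cf fM.
  (* The closeness estimates hold for small positive [l]; positivity of [u] turns convergence to 0
     into convergence from the right. *)
  have uc' : u k @[k --> \oo] --> 0^'+.
    move=> A A0.
    have uA : \forall k \near \oo, 0 < u k -> A (u k) := uc _ A0.
    by apply: (filterS _ uA) => k; apply; exact: u0.
  exact: uc' H.
move=> Q.
have Qfin (f : vague R G -> R) : continuous f -> (exists M, forall c, `|f c| <= M) ->
    (\int[Q]_c (f c)%:E)%E \is a fin_num.
  move=> cf [M fM]; apply: integrable_fin_num => //.
  apply: measurable_bounded_integrable => //.
  - by apply: le_lt_trans (probability_le1 Q measurableT) _; exact: ltry.
  - exact: measurable_continuous_vague.
  - exists M; split; first exact: num_real.
    by move=> x Mx c _ /=; exact: le_trans (fM _) (ltW Mx).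
(* The same sequence [u] serves for both processes. *)
split=> -[u [u0 uc Hu]]; exists u; split => // f cf fM.
  rewrite -(fineK (Qfin f cf fM)).
  apply: (@cvg_of_close _ (fun k => \int[PX (u k)]_w (f (vor (X (u k) w)))%:E)%E).
    by move=> e e0; exact: close.
  by rewrite fineK ?Qfin//; exact: Hu.
rewrite -(fineK (Qfin f cf fM)).
apply: (@cvg_of_close _ (fun k =>
    \int[PY (u k)]_w (f (vor (multiset_of (Y (u k) w))))%:E)%E).
  move=> e e0; have := close u f e u0 uc e0 cf fM.
  by apply: filterS => k [].
by rewrite fineK ?Qfin//; exact: Hu.
Qed.
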